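(* Let $g,h:\mathbb{C}^n\to\mathbb{C}$ be complex polynomials, with $h$ not identically zero, such that $S(g/h)\subset\{0\}$. Then $M\left(\frac{g\bar h}{|g\bar h|}\right)$ is bounded.
   Context: Here $g\bar h$ denotes the product of $g$ with the complex conjugate of $h$. The quotient $g/h$ is considered as a map on the open set $\mathbb{C}^n\setminus\{h=0\}$. Milnor sets. $M(g/h)$ is the set of points $x\in\mathbb{C}^n\setminus\{h=0\}$ at which the Euclidean distance function and $g/h$ are not transversal, i.e. at which $(\|x\|^2,g/h)$, viewed as a real map to $\mathbb{R}\times\mathbb{C}=\mathbb{R}^3$, is not a submersion. $M(g\bar h/|g\bar h|)$ is the set of points $x\in\mathbb{C}^n\setminus\{gh=0\}$ at which $\left(\|x\|^2,\frac{g\bar h}{|g\bar h|}\right)$, viewed as a map to $\mathbb{R}\times S^1_1$ ($S^1_1$ the unit circle), is not a submersion. The set of asymptotic $\rho$-nonregular values is $$S(g/h):=\{t_0\in\mathbb{C}\mid \exists \{x_j\}_{j\in\mathbb{N}}\subset M(g/h),\ \lim_{j\to\infty}\|x_j\|=\infty \text{ and } \lim_{j\to\infty}(g/h)(x_j)=t_0\}.$$ *)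

(* Defs.v *)
From mathcomp Require Import all_boot all_order all_algebra.
From mathcomp Require Import all_classical all_reals all_analysis.
From mathcomp Require Import complex.
(* Not imported: the notations of [mpoly] clash with those of the analysis
   library. *)
From mathcomp Require mpoly.

Set Implicit Arguments.
Unset Strict Implicit.
Unset Printing Implicit Defensive.

Import Order.TTheory GRing.Theory Num.Theory.
Import numFieldNormedType.Exports.

Local Open Scope classical_set_scope.
Local Open Scope ring_scope.

(* Complex polynomials in [n] variables. *)
Definition cpoly (R : realType) (n : nat) : Type := mpoly.mpoly n R[i].

(* The real normed spaces underlying C and C^n: z is represented by
   (Re z, Im z), coordinatewise for C^n. The library norms on these products
   are sup norms; the Euclidean one is [enorm] below. *)
Notation realC R := (R * R)%type.
Notation realCn R n := ('rV[R]_n * 'rV[R]_n)%type.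

Section MilnorSets.
Context {R : realType}.

Definition toRealC (z : R[i]) : realC R := (complex.Re z, complex.Im z).

Section Cn.
Context {n : nat}.
Implicit Types (g h : cpoly R n) (x : realCn R n).

Definition zcoord x (j : 'I_n) : R[i] := (x.1 0 j +i* x.2 0 j)%C.

Definition peval g x : R[i] := mpoly.meval (zcoord x) g.

Definition sqenorm x : R := \sum_(j < n) (x.1 0 j ^+ 2 + x.2 0 j ^+ 2).

Definition enorm x : R := Num.sqrt (sqenorm x).

(* Meaningful only where [h] does not vanish. *)
Definition pquot g h x : R[i] := peval g x / peval h x.

(* Meaningful only where neither [g] nor [h] vanishes; [`|z|] is the modulus
   of [z], seen as an element of [R[i]]. *)
Definition arg_map g h x : R[i] :=
  let z := peval g x * conjc (peval h x) in z / `|z|.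

End Cn.

(* [T] is the tangent space at [f x] of the (sub)manifold of [W] in which [f]
   takes its values near [x]. *)
Definition submersion_at {V W : normedModType R} (T : set W) (f : V -> W)
    (x : V) : Prop :=
  differentiable f x /\ range ('d f x) = T.

(* The tangent line at [p] to the unit circle. *)
Definition tangent_circle (p : realC R) : set (realC R) :=
  [set v | p.1 * v.1 + p.2 * v.2 = 0].

Definition milnor_quot {n : nat} (g h : cpoly R n) : set (realCn R n) :=
  [set x | peval h x != 0 /\
    ~ submersion_at [set: R * realC R]
        (fun y => (sqenorm y, toRealC (pquot g h y))) x].

Definition milnor_arg {n : nat} (g h : cpoly R n) : set (realCn R n) :=
  [set x | peval g x * peval h x != 0 /\
    ~ submersion_at ([set: R] `*` tangent_circle (toRealC (arg_map g h x)))
        (fun y => (sqenorm y, toRealC (arg_map g h y))) x].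

Definition asymp_nonregular_values {n : nat} (g h : cpoly R n) : set R[i] :=
  [set t0 | exists x : nat -> realCn R n,
    [/\ forall j, milnor_quot g h (x j),
        enorm (x j) @[j --> \oo] --> +oo &
        toRealC (pquot g h (x j)) @[j --> \oo] --> toRealC t0]].

End MilnorSets.

(* Main.v *)
Require Import Defs.
From mathcomp Require Import all_boot all_order all_algebra.
From mathcomp Require Import all_classical all_reals all_analysis.
From mathcomp Require Import complex.
From mathcomp Require Import polyXY polyrcf ordered_qelim.
From mathcomp Require Import ring lra.
(* [mpoly] without its notations, which clash with those of the analysis
   library; [qe_rcf] without its notation for [False]. *)
From mathcomp Require Import (canonicals, coercions) mpoly.
From mathcomp Require qe_rcf.

(* Write f = g / h. A point of the Milnor set of the argument other than the
   origin is one where the gradient of log f is a purely imaginary multiple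
   i l z of z; such points lie in the Milnor set of f. If they were unbounded,
   quantifier elimination over the reals would give a semialgebraic curve z(r)
   of such points, with |z|^2 = r for all large r. Along it,
     (log f)' = i l <z', z>   and   Re <z', z> = 1/2.
   A bounded semialgebraic function a(r) satisfies r a'(r) -> 0, for otherwise
   it would grow at least like log r; applied to quotients of coordinates this
   says that a planar semialgebraic curve (a, b) does not spiral:
     r (a b' - b a') = o(a^2 + b^2).
   For the coordinates of z this bounds Im <z', z>, and for those of f it gives
   r l -> 0. Hence r (log |f|)' -> 0, which excludes |f| -> 0 and |f| -> oo,
   because semialgebraic functions grow polynomially. So f(z(r)) has a nonzero
   finite limit, an asymptotic nonregular value other than 0. *)

Import Order.TTheory GRing.Theory Num.Theory.
Import numFieldNormedType.Exports.

Local Open Scope classical_set_scope.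
Local Open Scope ring_scope.

Set Implicit Arguments.
Unset Strict Implicit.
Unset Printing Implicit Defensive.

(** * Definable sets and quantifier elimination *)

(** The obstacle is that the curve comes from a choice of points: a priori its coordinates are
    arbitrary semialgebraic functions of r, with no continuity or monotonicity. Neither cell
    decomposition nor Puiseux expansions are used. The main form of tameness is a dichotomy: a
    definable property of r holds for all large r or fails for all large r, so it is eventually true
    as soon as it is true for arbitrarily large r. Being differentiable at r is such a property,
    since the derivative is described by a first-order formula; arbitrarily large points of
    differentiability therefore suffice, and they come from a countability argument. Parametrizing
    by r = |z|^2 makes Re <z', z> constant, so that l can be read off from the rotation of f = a + i
    b: the quantity a b' - b a' equals |f|^2 l / 2. No other control of l is needed. Since 0 is
    allowed as an asymptotic value, boundedness of f alone would not conclude; the growth argument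
    is applied both to |f|^2 and to its inverse. *)

Definition scons (A : Type) (x : A) (E : nat -> A) : nat -> A :=
  fun i => if i is j.+1 then E j else x.
Local Notation "x .: E" := (scons x E) (at level 55, right associativity).

Section Definable.
Context {R : realType}.
Implicit Types (E : nat -> R) (S : (nat -> R) -> Prop) (T : (nat -> R) -> R).

Inductive polyfun : ((nat -> R) -> R) -> Prop :=
| polyfun_var i : polyfun (fun E => E i)
| polyfun_const c : polyfun (fun=> c)
| polyfun_add p q : polyfun p -> polyfun q -> polyfun (fun E => p E + q E)
| polyfun_mul p q : polyfun p -> polyfun q -> polyfun (fun E => p E * q E).

Lemma polyfun_opp p : polyfun p -> polyfun (fun E => - p E).
Proof.
move=> pp; rewrite (_ : (fun E => _) = (fun E => (-1) * p E)).
  by apply: polyfun_mul => //; exact: polyfun_const.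
by apply/funext => E; rewrite mulN1r.
Qed.

(** Quantifiers are not among the generators: closure under them is [definable_ex], and inductions
    on definable sets have three cases only. Environments are infinite, so no arity has to be
    tracked. *)
Inductive definable : ((nat -> R) -> Prop) -> Prop :=
| definable_gt0 p : polyfun p -> definable (fun E => 0 < p E)
| definable_and S1 S2 :
    definable S1 -> definable S2 -> definable (fun E => S1 E /\ S2 E)
| definable_not S : definable S -> definable (fun E => ~ S E).

Lemma definable_ext S1 S2 :
  (forall E, S1 E <-> S2 E) -> definable S1 -> definable S2.
Proof.
move=> e; rewrite (_ : S1 = S2) //.
by apply/funext => E; apply/propext.
Qed.

Lemma definable_or S1 S2 :
  definable S1 -> definable S2 -> definable (fun E => S1 E \/ S2 E).
Proof.
move=> d1 d2; apply: (@definable_ext (fun E => ~ (~ S1 E /\ ~ S2 E))).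
  by move=> E; rewrite not_andE !notK.
by apply/definable_not/definable_and; exact: definable_not.
Qed.

Lemma definable_imp S1 S2 :
  definable S1 -> definable S2 -> definable (fun E => S1 E -> S2 E).
Proof.
move=> d1 d2; apply: (@definable_ext (fun E => ~ S1 E \/ S2 E)).
  by move=> E; rewrite implyE.
by apply: definable_or => //; exact: definable_not.
Qed.

Lemma definable_plt p q : polyfun p -> polyfun q ->
  definable (fun E => p E < q E).
Proof.
move=> pp pq; apply: (@definable_ext (fun E => 0 < q E + - p E)).
  by move=> E; rewrite subr_gt0.
by apply/definable_gt0/polyfun_add => //; exact: polyfun_opp.
Qed.

Lemma definable_ple p q : polyfun p -> polyfun q ->
  definable (fun E => p E <= q E).
Proof.
move=> pp pq; apply: (@definable_ext (fun E => ~ (q E < p E))).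
  by move=> E; rewrite leNgt; split => /negP.
exact/definable_not/definable_plt.
Qed.

Lemma definable_peq p q : polyfun p -> polyfun q ->
  definable (fun E => p E = q E).
Proof.
move=> pp pq; apply: (@definable_ext (fun E => p E <= q E /\ q E <= p E)).
  by move=> E; split=> [[h1 h2]|->//]; apply/le_anti/andP.
by apply: definable_and; exact: definable_ple.
Qed.

Lemma polyfun_rename p (rho : nat -> nat) : polyfun p ->
  polyfun (fun E => p (fun i => E (rho i))).
Proof. by elim=> *; constructor. Qed.

Lemma definable_rename S (rho : nat -> nat) : definable S ->
  definable (fun E => S (fun i => E (rho i))).
Proof.
elim=> [p pp|S1 S2 _ h1 _ h2|S1 _ h1].
- exact/definable_gt0/polyfun_rename.
- exact: definable_and.
- exact: definable_not.
Qed.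

(** * Translation to first-order formulas and back *)

Lemma nth_mkseqE M (E : nat -> R) i : (i < M)%N -> (mkseq E M)`_i = E i.
Proof. by move=> iM; rewrite nth_mkseq. Qed.

(* Environments are infinite here and finite in the library; [M] bounds the
   variables that occur. *)
Lemma polyfun_term p : polyfun p -> exists t M,
  GRing.rterm t /\ forall (e : seq R) E, (forall i, (i < M)%N -> e`_i = E i) ->
    GRing.eval e t = p E.
Proof.
elim=> [i|c|p1 p2 _ [t1 [M1 [r1 h1]]] _ [t2 [M2 [r2 h2]]]
             |p1 p2 _ [t1 [M1 [r1 h1]]] _ [t2 [M2 [r2 h2]]]].
- by exists (GRing.Var R i), i.+1; split=> // e E; exact.
- by exists (GRing.Const c), 0%N.
- exists (GRing.Add t1 t2), (maxn M1 M2); rewrite /= r1 r2; split=> // e E hE.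
  by rewrite (h1 e E) ?(h2 e E) // => i iM; apply: hE; rewrite leq_max iM ?orbT.
- exists (GRing.Mul t1 t2), (maxn M1 M2); rewrite /= r1 r2; split=> // e E hE.
  by rewrite (h1 e E) ?(h2 e E) // => i iM; apply: hE; rewrite leq_max iM ?orbT.
Qed.

Lemma definable_formula S : definable S -> exists f M,
  ord.rformula f /\ forall (e : seq R) E, (forall i, (i < M)%N -> e`_i = E i) ->
    (ord.holds e f <-> S E).
Proof.
elim=> [p /polyfun_term[t [M [rt ht]]]|
   S1 S2 _ [f1 [M1 [r1 h1]]] _ [f2 [M2 [r2 h2]]]|S1 _ [f1 [M1 [r1 h1]]]].
- by exists (ord.Lt (GRing.Const 0) t), M; split=> // e E /ht /= ->.
- exists (ord.And f1 f2), (maxn M1 M2); rewrite /= r1 r2; split=> // e E hE.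
  by rewrite (h1 e E) ?(h2 e E) // => i iM; apply: hE; rewrite leq_max iM ?orbT.
- by exists (ord.Not f1), M1; split=> //= e E /h1 ->.
Qed.

Lemma term_polyfun t (v : (nat -> R) -> seq R) : GRing.rterm t ->
  (forall i, polyfun (fun E => (v E)`_i)) ->
  polyfun (fun E => GRing.eval (v E) t).
Proof.
move=> + hv; elim: t => //=.
- by move=> c _; exact: polyfun_const.
- by move=> n _; exact: polyfun_const.
- by move=> t1 h1 t2 h2 /andP[/h1 ? /h2 ?]; exact: polyfun_add.
- by move=> t1 h1 /h1 ?; exact: polyfun_opp.
- move=> t1 h1 n /h1 h; elim: n => [|n IHn]; first exact: polyfun_const.
  under eq_fun do rewrite mulrS.
  exact: polyfun_add.
- by move=> t1 h1 t2 h2 /andP[/h1 ? /h2 ?]; exact: polyfun_mul.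
- move=> t1 h1 n /h1 h; elim: n => [|n IHn]; first exact: polyfun_const.
  under eq_fun do rewrite exprS.
  exact: polyfun_mul.
Qed.

(** The entries of the valuation may be any polynomial functions of the environment, which covers
    both its truncation to a list and a dummy entry. *)
Lemma qf_definable (f : ord.formula R) (v : (nat -> R) -> seq R) :
  ord.qf_form f && ord.rformula f ->
  (forall i, polyfun (fun E => (v E)`_i)) ->
  definable (fun E => ord.qf_eval (v E) f).
Proof.
move=> + hv; have tp t : GRing.rterm t -> polyfun (fun E => GRing.eval (v E) t).
  by move=> rt; exact: term_polyfun.
elim: f => //=.
- move=> b _; apply: (@definable_ext (fun E => (b%:R : R) = 1)).
    by move=> E; case: b; split=> // /esym/eqP; rewrite oner_eq0.
  by apply: definable_peq; exact: polyfun_const.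
- move=> t1 t2 /andP[r1 r2].
  apply: (@definable_ext (fun E => GRing.eval (v E) t1 = GRing.eval (v E) t2)).
    by move=> E; split=> /eqP.
  by apply: definable_peq; exact: tp.
- by move=> t1 t2 /andP[r1 r2]; apply: definable_plt; exact: tp.
- by move=> t1 t2 /andP[r1 r2]; apply: definable_ple; exact: tp.
- move=> f1 h1 f2 h2 /andP[/andP[q1 q2] /andP[r1 r2]].
  apply: definable_ext (definable_and (h1 _) (h2 _)); rewrite ?q1 ?q2 //.
  by move=> E; split=> /andP.
- move=> f1 h1 f2 h2 /andP[/andP[q1 q2] /andP[r1 r2]].
  apply: definable_ext (definable_or (h1 _) (h2 _)); rewrite ?q1 ?q2 //.
  by move=> E; split=> /orP.
- move=> f1 h1 f2 h2 /andP[/andP[q1 q2] /andP[r1 r2]].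
  apply: definable_ext (definable_imp (h1 _) (h2 _)); rewrite ?q1 ?q2 //.
  by move=> E; split=> /implyP.
- move=> f1 h1 /h1 h; apply: definable_ext (definable_not h).
  by move=> E; split=> /negP.
Qed.

(** Tarski-Seidenberg: [S] is turned into a formula, the quantifier over variable 0 is eliminated,
    and the quantifier-free result is read back as a definable set. *)
Lemma definable_ex S : definable S ->
  definable (fun E => exists x, S (x .: E)).
Proof.
move=> /definable_formula[f [M [rf hf]]].
pose g := ord.quantifier_elim
  (fun i s => qe_rcf.qfr_to_formula (@qe_rcf.wproj R i s)) (ord.Exists 0 f).
have rE : ord.rformula (ord.Exists 0 f) by [].
(* [Exists 0] overwrites entry 0 of the valuation, so the value put there is arbitrary. *)
pose v E := 0 :: mkseq E M.
apply: (@definable_ext (fun E => ord.qf_eval (v E) g)).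
  move=> E.
  have hS x : ord.holds (x :: mkseq E M) f <-> S (x .: E).
    by apply: hf => -[|i] // iM; rewrite /= nth_mkseq // ltnW.
  have qeP := ord.quantifier_elim_rformP (@qe_rcf.wf_QE_wproj R)
                (@qe_rcf.valid_QE_wproj R) (v E) rE.
  split=> [/qeP[x hx]|[x hx]]; first by exists x; exact: (hS x).1 hx.
  by apply/qeP; exists x; exact: (hS x).2 hx.
apply: qf_definable.
  exact: (ord.quantifier_elim_wf (@qe_rcf.wf_QE_wproj R)).
case=> [|i] /=; first exact: polyfun_const.
have [iM|Mi] := ltnP i M.
  by under eq_fun do rewrite nth_mkseqE //; exact: polyfun_var.
under eq_fun do rewrite nth_default ?size_mkseq //.
exact: polyfun_const.
Qed.

Lemma definable_exists (B : R -> (nat -> R) -> Prop) :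
  definable (fun E => B (E 0%N) (fun i => E i.+1)) ->
  definable (fun E => exists x, B x E).
Proof. by move/definable_ex. Qed.

Lemma definable_forall (B : R -> (nat -> R) -> Prop) :
  definable (fun E => B (E 0%N) (fun i => E i.+1)) ->
  definable (fun E => forall x, B x E).
Proof.
move=> d; apply: (@definable_ext (fun E => ~ exists x, ~ B x E)).
  by move=> E; split=> [/forallNP h x|h [x]]; [exact: contrapT (h x)|exact].
by apply/definable_not/definable_exists/definable_not.
Qed.

(** Only the graph has to be definable, so that inverses, infima and choice functions are terms on a
    par with polynomials. *)
Definition dterm T := definable (fun E => E 0%N = T (fun i => E i.+1)).

Lemma definable_let T S : dterm T -> definable S ->
  definable (fun E => S (T E .: E)).
Proof.
move=> dT dS.
apply: (@definable_ext (fun E => exists x, x = T E /\ S (x .: E))).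
  by move=> E; split=> [[x [->]]|h] //; exists (T E).
exact: (definable_ex (definable_and dT dS)).
Qed.

Lemma dterm_polyfun T : polyfun T -> dterm T.
Proof.
move=> pT; apply: definable_peq; first exact: polyfun_var.
exact: polyfun_rename.
Qed.

Lemma dterm_var i : dterm (fun E => E i).
Proof. exact/dterm_polyfun/polyfun_var. Qed.

Lemma dterm_const c : dterm (fun=> c).
Proof. exact/dterm_polyfun/polyfun_const. Qed.

Lemma dterm_rename T (rho : nat -> nat) : dterm T ->
  dterm (fun E => T (fun i => E (rho i))).
Proof.
move=> dT.
exact: (definable_rename (fun i => if i is j.+1 then (rho j).+1 else 0%N) dT).
Qed.

Lemma definable_let2 T1 T2 S : dterm T1 -> dterm T2 -> definable S ->
  definable (fun E => S (T2 E .: T1 E .: E)).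
Proof.
move=> d1 d2 dS.
exact: (definable_let d1 (definable_let (dterm_rename succn d2) dS)).
Qed.

Lemma definable_lt T1 T2 : dterm T1 -> dterm T2 ->
  definable (fun E => T1 E < T2 E).
Proof.
move=> d1 d2; have h := definable_plt (polyfun_var 1) (polyfun_var 0).
exact: (definable_let2 d1 d2 h).
Qed.

Lemma definable_le T1 T2 : dterm T1 -> dterm T2 ->
  definable (fun E => T1 E <= T2 E).
Proof.
move=> d1 d2; have h := definable_ple (polyfun_var 1) (polyfun_var 0).
exact: (definable_let2 d1 d2 h).
Qed.

Lemma definable_eq T1 T2 : dterm T1 -> dterm T2 ->
  definable (fun E => T1 E = T2 E).
Proof.
move=> d1 d2; have h := definable_peq (polyfun_var 1) (polyfun_var 0).
exact: (definable_let2 d1 d2 h).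
Qed.

Lemma dterm_op2 T1 T2 (p : R -> R -> R) : dterm T1 -> dterm T2 ->
  polyfun (fun E => p (E 0%N) (E 1%N)) -> dterm (fun E => p (T1 E) (T2 E)).
Proof.
move=> d1 d2 pp.
apply: (definable_let2 (dterm_rename succn d2) (dterm_rename succn d1)
         (S := fun E => E 2%N = p (E 0%N) (E 1%N))).
by apply: definable_peq => //; exact: polyfun_var.
Qed.

Lemma dtermD T1 T2 : dterm T1 -> dterm T2 -> dterm (fun E => T1 E + T2 E).
Proof.
by move=> d1 d2; apply: (dterm_op2 (p := +%R)) => //; apply: polyfun_add;
  exact: polyfun_var.
Qed.

Lemma dtermM T1 T2 : dterm T1 -> dterm T2 -> dterm (fun E => T1 E * T2 E).
Proof.
by move=> d1 d2; apply: (dterm_op2 (p := *%R)) => //; apply: polyfun_mul;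
  exact: polyfun_var.
Qed.

Lemma dtermN T : dterm T -> dterm (fun E => - T E).
Proof.
move=> d; under eq_fun do rewrite -mulN1r.
by apply: dtermM => //; exact: dterm_const.
Qed.

Lemma dtermB T1 T2 : dterm T1 -> dterm T2 -> dterm (fun E => T1 E - T2 E).
Proof. by move=> d1 d2; apply: dtermD => //; exact: dtermN. Qed.

Lemma dtermX T n : dterm T -> dterm (fun E => T E ^+ n).
Proof.
move=> d; elim: n => [|n IHn]; first exact: dterm_const.
by under eq_fun do rewrite exprS; exact: dtermM.
Qed.

Lemma dterm_sum (I : Type) (s : seq I) (T : I -> (nat -> R) -> R) :
  (forall i, dterm (T i)) -> dterm (fun E => \sum_(i <- s) T i E).
Proof.
move=> d; elim: s => [|i s IHs].
  by under eq_fun do rewrite big_nil; exact: dterm_const.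
by under eq_fun do rewrite big_cons; exact: dtermD.
Qed.

Lemma dterm_ext T1 T2 : T1 =1 T2 -> dterm T1 -> dterm T2.
Proof. by move=> /funext ->. Qed.

Lemma dterm_if S T1 T2 : definable S -> dterm T1 -> dterm T2 ->
  dterm (fun E => if `[< S E >] then T1 E else T2 E).
Proof.
move=> dS d1 d2.
apply: (@definable_ext (fun E =>
  (S (fun i => E i.+1) /\ E 0%N = T1 (fun i => E i.+1)) \/
  (~ S (fun i => E i.+1) /\ E 0%N = T2 (fun i => E i.+1)))).
  move=> E; case: asboolP => h; split; tauto.
have dS' := definable_rename succn dS.
by apply: definable_or; apply: definable_and => //; exact: definable_not.
Qed.

Lemma dtermV T : dterm T -> dterm (fun E => (T E)^-1).
Proof.
move=> d; apply: (definable_let (dterm_rename succn d)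
  (S := fun E => E 1%N = (E 0%N)^-1)).
(* The second disjunct is the convention that the inverse of 0 is 0. *)
apply: (@definable_ext (fun E =>
   E 0%N * E 1%N = 1 \/ E 0%N = 0 /\ E 1%N = 0)).
  move=> E; split=> [[h|[-> ->]]|->]; last 2 first.
  - by rewrite invr0.
  - have [->|nz] := eqVneq (E 0%N) 0; last by left; rewrite mulfV.
    by right; rewrite invr0.
  have nz : E 0%N != 0.
    by apply: contra_eq_neq h => ->; rewrite mul0r eq_sym oner_neq0.
  by apply: (mulfI nz); rewrite h mulfV.
have dc c : definable (fun E => E 0%N = c).
  exact: definable_eq (dterm_var _) (dterm_const _).
apply: definable_or.
  exact: definable_eq (dtermM (dterm_var _) (dterm_var _)) (dterm_const _).
exact: definable_and (dc 0) (definable_rename succn (dc 0)).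
Qed.

(** Being the greatest lower bound is a first-order condition. The default must be definable as
    well: [inf] is 0 on a set that is empty or not bounded below. *)
Lemma dterm_inf S : definable S -> dterm (fun E => inf [set x | S (x .: E)]).
Proof.
move=> dS.
pose lb y E := forall x, S (x .: E) -> y <= x.
pose has E := (exists x, S (x .: E)) /\ exists y, lb y E.
have dl0 : definable (fun E => lb (E 0%N) (fun i => E i.+1)).
  apply: definable_forall; apply: definable_imp.
    have := definable_rename (fun i => if i is j.+1 then j.+2 else 0%N) dS.
    apply: definable_ext => E.
    rewrite (_ : (fun i => _) = (E 0%N .: (fun i => E i.+2))) //.
    by apply/funext => -[|i].
  by apply: definable_le; exact: dterm_var.
have dhas : definable has.
  by apply: definable_and; [exact: definable_ex | exact: definable_ex dl0].
apply: (@definable_ext (fun E => let F i := E i.+1 in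
  (has F /\ (lb (E 0%N) F /\ forall y, lb y F -> y <= E 0%N)) \/
  (~ has F /\ E 0%N = 0))); last first.
  apply: definable_or; apply: definable_and.
  - exact: (definable_rename succn dhas).
  - apply: definable_and => //; apply: definable_forall; apply: definable_imp.
      exact: (definable_rename (fun i => if i is j.+1 then j.+2 else 0%N) dl0).
    by apply: definable_le; exact: dterm_var.
  - by apply: definable_not; exact: (definable_rename succn dhas).
  - by apply: definable_eq; [exact: dterm_var|exact: dterm_const].
move=> E; set F := fun i => E i.+1 => /=.
have hasE : has F <-> has_inf [set x | S (x .: F)].
  by split=> -[h1 [y h2]]; split=> //; exists y.
split=> [[[/hasE hi [h1 h2]]|[/hasE hi ->]]|->].
- apply/le_anti/andP; split.
    by apply: lb_le_inf; [exact: hi.1|exact: h1].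
  by apply: h2 => x Sx; apply: ge_inf => //; exact: hi.2.
- by rewrite inf_out.
- have [hi|hi] := pselect (has F); last by right; rewrite inf_out // => /hasE.
  have hi' := hasE.1 hi.
  left; split=> //; split=> [x Sx|y ly].
    by apply: ge_inf => //; exact: hi'.2.
  by apply: lb_le_inf; [exact: hi'.1|exact: ly].
Qed.

Lemma definable_subst S (sigma : nat -> (nat -> R) -> R) :
  definable S -> (forall i, dterm (sigma i)) ->
  definable (fun E => S (sigma^~ E)).
Proof.
move=> dS dsg; elim: dS => [p pp|S1 S2 _ d1 _ d2|S1 _ d1].
- apply: definable_lt; first exact: dterm_const.
  elim: pp => [i|c|p1 p2 _ d1 _ d2|p1 p2 _ d1 _ d2].
  + exact: dsg.
  + exact: dterm_const.
  + exact: dtermD.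
  + exact: dtermM.
- exact: definable_and.
- exact: definable_not.
Qed.

Lemma dterm_subst T (sigma : nat -> (nat -> R) -> R) :
  dterm T -> (forall i, dterm (sigma i)) -> dterm (fun E => T (sigma^~ E)).
Proof.
move=> dT dsg.
pose sg i E := if i is j.+1 then sigma j (fun i => E i.+1) else E 0%N.
apply: (definable_subst (sigma := sg) dT) => -[|i]; first exact: dterm_var.
exact: (dterm_rename succn (dsg i)).
Qed.

End Definable.

(** * Definable sets of one variable and definable choice *)

Section OneVariable.
Context {R : realType}.
Implicit Types (E : nat -> R) (S : (nat -> R) -> Prop) (T : (nat -> R) -> R).

Lemma noroot_gt0 (q : {poly R}) a b : a <= b ->
  (forall x, a <= x <= b -> q.[x] != 0) -> (0 < q.[a]) = (0 < q.[b]).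
Proof.
move=> ab nr; rewrite -!sgr_cp0.
have nr' : {in `[a, b], forall x, ~~ root q x}.
  by move=> x; rewrite in_itv /= => /nr; rewrite rootE.
by rewrite (polyrN0_itv nr' (y := a) (x := b)) // in_itv /= lexx ab.
Qed.

Lemma polyfun_poly p E : polyfun p ->
  exists q : {poly R}, forall x, p (x .: E) = q.[x].
Proof.
elim=> [[|i]|c|p1 p2 _ [q1 h1] _ [q2 h2]|p1 p2 _ [q1 h1] _ [q2 h2]].
- by exists 'X => x; rewrite hornerX.
- by exists (E i)%:P => x; rewrite hornerC.
- by exists c%:P => x; rewrite hornerC.
- by exists (q1 + q2) => x; rewrite hornerD h1 h2.
- by exists (q1 * q2) => x; rewrite hornerM h1 h2.
Qed.

Lemma polyfun_poly2 p E : polyfun p -> exists q : {poly {poly R}},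
  forall x y, p (x .: y .: E) = q.[x%:P].[y].
Proof.
elim=> [[|[|i]]|c|p1 p2 _ [q1 h1] _ [q2 h2]|p1 p2 _ [q1 h1] _ [q2 h2]].
- by exists 'X => x y; rewrite hornerX hornerC.
- by exists ('X)%:P => x y; rewrite hornerC hornerX.
- by exists (E i)%:P%:P => x y; rewrite !hornerC.
- by exists c%:P%:P => x y; rewrite !hornerC.
- by exists (q1 + q2) => x y; rewrite !hornerD h1 h2.
- by exists (q1 * q2) => x y; rewrite !hornerM h1 h2.
Qed.

(** An atom changes its truth value only at roots of its polynomial, and the product of the
    polynomials of all atoms serves for the whole combination. An atom with zero polynomial is
    constantly false, and 1 takes its place. *)
Lemma definable_const_off_roots S E : definable S ->
  exists2 q : {poly R}, q != 0 & forall a b, a <= b ->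
    (forall x, a <= x <= b -> q.[x] != 0) -> (S (a .: E) <-> S (b .: E)).
Proof.
elim=> [p pp|S1 S2 _ [q1 n1 h1] _ [q2 n2 h2]|S1 _ [q1 n1 h1]].
- have [q hq] := polyfun_poly E pp.
  exists (if q == 0 then 1 else q).
    by have [_|//] := eqVneq q 0; rewrite oner_neq0.
  move=> a b ab nr; rewrite !hq.
  have [->|q0] := eqVneq q 0; first by rewrite !horner0.
  rewrite (negPf q0) in nr.
  by rewrite (noroot_gt0 ab nr).
- exists (q1 * q2); first by rewrite mulf_neq0.
  move=> a b ab nr; rewrite (h1 a b) ?(h2 a b) // => x xab;
    have := nr x xab; rewrite hornerM mulf_eq0 negb_or => /andP[].
  + by [].
  + by [].
- by exists q1 => // a b ab nr; rewrite (h1 a b).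
Qed.

(** The same polynomial serves for all [y]. It is nonzero in two variables but may vanish
    identically for some values of [y], where the claim is void. The outer variable of [q] is
    evaluated at the first entry of the environment. *)
Lemma definable_const_off_roots2 S E : definable S ->
  exists2 q : {poly {poly R}}, q != 0 & forall y a b, a <= b ->
    (forall x, a <= x <= b -> q.[x%:P].[y] != 0) ->
    (S (a .: y .: E) <-> S (b .: y .: E)).
Proof.
elim=> [p pp|S1 S2 _ [q1 n1 h1] _ [q2 n2 h2]|S1 _ [q1 n1 h1]].
- have [q hq] := polyfun_poly2 E pp.
  exists (if q == 0 then 1 else q).
    by have [_|//] := eqVneq q 0; rewrite oner_neq0.
  move=> y a b ab nr; rewrite !hq.
  have [->|q0] := eqVneq q 0; first by rewrite !horner0.
  rewrite (negPf q0) in nr.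
  have e x : q.[x%:P].[y] = (map_poly (horner_eval y) q).[x].
    have := horner_map (horner_eval y) q x%:P.
    by rewrite /= /horner_eval hornerC.
  rewrite !e (noroot_gt0 ab) // => x /nr.
  by rewrite e.
- exists (q1 * q2); first by rewrite mulf_neq0.
  move=> y a b ab nr; rewrite (h1 y a b) ?(h2 y a b) // => x xab;
    have := nr x xab; rewrite !hornerM mulf_eq0 negb_or => /andP[].
  + by [].
  + by [].
- by exists q1 => // y a b ab nr; rewrite (h1 y a b).
Qed.

(** There is no root beyond the Cauchy bound. This dichotomy is the source of every passage from
    arbitrarily large r to all large r. *)
Lemma definable_near_pinfty S E : definable S ->
  (\forall r \near +oo, S (r .: E)) \/ (\forall r \near +oo, ~ S (r .: E)).
Proof.
move=> /(definable_const_off_roots E)[q q0 hq].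
pose M := cauchy_bound q.
have h r : M < r -> (S (M .: E) <-> S (r .: E)).
  move=> Mr; apply: hq; first exact: ltW.
  move=> x /andP[Mx _]; have := ge_cauchy_bound q0 (x := x).
  by rewrite in_itv /= Mx => /(_ isT); rewrite rootE.
have [SM|SM] := pselect (S (M .: E)); [left|right];
  by near=> r; rewrite -h //; near: r; apply: nbhs_pinfty_gt; rewrite num_real.
Unshelve. all: by end_near. Qed.

Lemma definable_right S E a : definable S -> exists2 b, a < b &
  (forall x, a < x < b -> S (x .: E)) \/ (forall x, a < x < b -> ~ S (x .: E)).
Proof.
move=> /(definable_const_off_roots E)[q q0 hq].
pose b := next_root q a (a + 1); exists b.
  by apply: next_root_gt => //; rewrite ltrDl.
have h x y : a < x < b -> a < y < b -> (S (x .: E) <-> S (y .: E)).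
  wlog xy : x y / x <= y => [hw|/andP[ax xb] /andP[ay yb]].
    by move=> hx hy; have /orP[xy|xy] := le_total x y;
      [exact: hw|apply: iff_sym; exact: hw].
  apply: hq => // z /andP[xz zy].
  have := @next_noroot _ q a (a + 1) z.
  by rewrite in_itv /= (lt_le_trans ax xz) (le_lt_trans zy yb) rootE; exact.
have [[x [xab Sx]]|nS] := pselect (exists x, a < x < b /\ S (x .: E)).
  by left=> y yab; apply/(h x y).
by right=> x xab Sx; apply: nS; exists x.
Qed.

Lemma poly_roots_finite (q : {poly R}) :
  q != 0 -> finite_set [set x | root q x].
Proof.
move=> q0; pose c := cauchy_bound q.
apply: (@sub_finite_set _ _ [set` roots q (- c) c]); last exact: finite_seq.
move=> x /= rx; rewrite (root_in_roots q0) //.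
exact: root_in_cauchy_bound.
Qed.

(** Roots are finite in number, so the set contains a point that is not a root of the polynomial
    above; no root lies close to that point, and membership persists to its right. *)
Lemma definable_uncountable S E : definable S ->
  ~ countable [set x | S (x .: E)] ->
  exists a b, a < b /\ forall x, a < x < b -> S (x .: E).
Proof.
move=> dS nc; have [q q0 hq] := definable_const_off_roots E dS.
have [[x [Sx rx]]|nS] := pselect (exists x, S (x .: E) /\ ~~ root q x);
  last first.
  exfalso; apply: nc.
  apply: sub_countable (finite_set_countable (poly_roots_finite q0)).
  apply: subset_card_le => x /= Sx; apply: contrapT => /negP rx.
  by apply: nS; exists x.
have e0 : 0 < `|q.[x]| by rewrite normr_gt0 -rootE.
have [d d0 hd] := @poly_cont _ x q _ e0.
have nr y : `|y - x| < d -> q.[y] != 0.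
  by move=> /hd; apply: contraTneq => ->; rewrite sub0r normrN ltxx.
exists x, (x + d); split=> [|y /andP[xy yd]]; first by rewrite ltrDl.
apply/(hq x y (ltW xy)) => // z /andP[xz zy]; apply: nr.
rewrite ger0_norm ?subr_ge0 //; lra.
Qed.

(** The chosen element is the infimum of the fibre when it is attained, and otherwise the midpoint
    of an interval of the fibre that starts at the infimum. Both are definable in the parameters. *)
Lemma definable_choice S : definable S ->
  exists2 c, dterm c & forall E, (exists x, S (x .: E)) -> S (c E .: E).
Proof.
move=> dS.
(* The absolute values of the elements of the fibre: this set is bounded below, so its infimum is
   meaningful, and the sign is restored at the end. *)
pose S2 E := 0 <= E 0%N /\ (S E \/ S (- E 0%N .: fun i => E i.+1)).
have d2 : definable S2.
  apply: definable_and.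
    exact: definable_le (dterm_const 0) (dterm_var 0).
  apply: definable_or => //.
  have := definable_rename (fun i => if i is j.+1 then j.+2 else 0%N) dS.
  move=> /(definable_let (dtermN (dterm_var 0))).
  apply: definable_ext => E.
  rewrite (_ : (fun i => _) = (- E 0%N .: fun i => E i.+1)) //.
  by apply/funext; case.
pose a E := inf [set y | S2 (y .: E)].
have da : dterm a by exact: dterm_inf.
(* Its infimum [b] is where the interval of [S2] to the right of [a] stops, cut off at [a + 1] so
   that [S3] is never empty. *)
pose S3 E := let F i := E i.+1 in
  a F < E 0%N /\ (~ S2 E \/ a F + 1 <= E 0%N).
have d3 : definable S3.
  have da' := dterm_rename succn da.
  apply: definable_and.
    exact: definable_lt da' (dterm_var 0).
  apply: definable_or; first exact: definable_not.
  exact: definable_le (dtermD da' (dterm_const 1)) (dterm_var 0).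
pose b E := inf [set y | S3 (y .: E)].
have db : dterm b by exact: dterm_inf.
pose m E := if `[< S2 (a E .: E) >] then a E else (a E + b E) * 2^-1.
have dm : dterm m.
  apply: dterm_if => //; first exact: definable_let.
  exact: dtermM (dtermD da db) (dterm_const _).
exists (fun E => if `[< S (m E .: E) >] then m E else - m E).
  by apply: dterm_if => //; [exact: definable_let|exact: dtermN].
move=> E [x0 Sx0].
suff: S2 (m E .: E).
  by case: asboolP => // nS [_ []].
have ne : [set y | S2 (y .: E)] !=set0.
  exists `|x0|; split=> //=.
  have [x0p|x0n] := lerP 0 x0; [left|right].
    by rewrite ger0_norm.
  by rewrite /= ltr0_norm // opprK (_ : (fun i => _) = E).
have lb : has_lbound [set y | S2 (y .: E)] by exists 0 => y [].
rewrite /m; case: asboolP => // nSa.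
have alt y : S2 (y .: E) -> a E < y.
  move=> Sy; rewrite lt_neqAle ge_inf // andbT.
  by apply: contra_notN nSa => /eqP ->.
have [c ac hc] := definable_right E (a E) d2.
have {hc} hc x : a E < x < c -> S2 (x .: E).
  case: hc => hc; first exact: hc.
  exfalso; have : c <= a E.
    apply: lb_le_inf => // y Sy; rewrite leNgt; apply/negP => yc.
    by apply: (hc y) => //; rewrite alt.
  by rewrite leNgt ac.
have bge : Num.min c (a E + 1) <= b E.
  apply: lb_le_inf.
    by exists (a E + 1); split=> /=; [rewrite ltrDl|right].
  move=> y [/= ay [nS|]]; last by rewrite ge_min => ->; rewrite orbT.
  rewrite ge_min leNgt; apply/orP; left; apply/negP => yc.
  by apply: nS; apply: hc; rewrite ay.
have ab : a E < b E.
  by rewrite (lt_le_trans _ bge) // lt_min ac ltrDl ltr01.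
apply: contrapT => nS.
have : b E <= (a E + b E) * 2^-1.
  apply: ge_inf; first by exists (a E) => y [/= /ltW].
  split=> /=; last by left.
  by rewrite ltr_pdivlMr //; lra.
by rewrite ler_pdivlMr //; lra.
Qed.

Fixpoint sapp (s : seq R) E := if s is x :: s' then x .: sapp s' E else E.

Lemma sapp_nth (s : seq R) E i : sapp s E i =
  if (i < size s)%N then s`_i else E (i - size s)%N.
Proof. by elim: s i => [|x s IHs] [|i] //=; rewrite IHs ltnS subSS. Qed.

(** The first entry is projected away, the remaining ones are chosen by induction, and the first is
    then chosen with these values substituted. *)
Lemma definable_choice_seq S k : definable S ->
  exists c : nat -> (nat -> R) -> R, (forall i, dterm (c i)) /\
    forall E, (exists2 s, size s = k & S (sapp s E)) ->
      S (sapp (mkseq (c^~ E) k) E).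
Proof.
elim: k S => [|k IHk] S dS.
  exists (fun _ _ => 0); split=> [i|E [s /size0nil -> //]]; exact: dterm_const.
have [c0 dc0 hc0] := definable_choice dS.
have [c [dc hc]] := IHk _ (definable_ex dS).
pose sg i E := sapp (mkseq (c^~ E) k) E i.
have dsg i : dterm (sg i).
  rewrite /sg; under eq_fun do rewrite sapp_nth size_mkseq.
  case: ltnP => ik; last exact: dterm_var.
  by under eq_fun do rewrite nth_mkseq //; exact: dc.
exists (fun i E => if i is j.+1 then c j E else c0 (sg^~ E)); split.
  by case=> [|i] //; exact: dterm_subst.
move=> E [[//|x s] [sk] Sx].
rewrite /mkseq /= (iotaDl 1 0 k) -map_comp.
apply: hc0; apply: hc; exists s => //.
by exists x.
Qed.

End OneVariable.

(** * Definable functions *)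

Section DefinableFunctions.
Context {R : realType}.
Implicit Types (E : nat -> R) (S : (nat -> R) -> Prop) (T : (nat -> R) -> R).
Implicit Types (a b : R -> R) (A : R -> Prop).

Lemma dterm_norm T : dterm T -> dterm (fun E => `|T E|).
Proof.
move=> d.
apply: dterm_ext (dterm_if (definable_le (dterm_const 0) d) d (dtermN d)) => E.
by case: asboolP => [/ger0_norm//|/negP]; rewrite -ltNge => /ltr0_norm.
Qed.

Definition dfun a := dterm (fun E => a (E 0%N)).

Lemma dterm_dfun a T : dfun a -> dterm T -> dterm (fun E => a (T E)).
Proof.
move=> da dT; pose sg i E := if i is j.+1 then E j else T E.
apply: (dterm_subst (sigma := sg) da).
by case=> [|i] //; exact: dterm_var.
Qed.

Lemma dfun_dterm T : dterm T -> dfun (fun r => T (r .: fun=> 0)).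
Proof.
move=> dT; pose sg i E : R := if i is 0%N then E 0%N else 0.
have dsg i : dterm (sg i).
  by case: i => [|i]; [exact: dterm_var|exact: dterm_const].
apply: dterm_ext (dterm_subst dT dsg) => E.
by congr T; apply/funext => -[|i].
Qed.

Definition dset A := definable (fun E => A (E 0%N)).

Lemma dset_near A : dset A ->
  (\forall r \near +oo, A r) \/ (\forall r \near +oo, ~ A r).
Proof. by move=> /(definable_near_pinfty (fun=> 0)). Qed.

Lemma dset_frequently A : dset A -> (forall M, exists2 r, M < r & A r) ->
  \forall r \near +oo, A r.
Proof.
move=> dA fr; have [//|[M [_ hM]]] := dset_near dA.
by have [r Mr Ar] := fr M; have := hM _ Mr.
Qed.

(** The fibre of the graph over r is the single point [a r], so membership changes there. If [q] did
    not vanish at that point, the nearby point [a r + d / 2] would lie on the graph too. *)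
Lemma dfun_algebraic a : dfun a ->
  exists2 q : {poly {poly R}}, q != 0 & forall r, q.[(a r)%:P].[r] = 0.
Proof.
move=> da.
have dS : definable (fun E => E 0%N = a (E 1%N)).
  by apply: definable_eq; [exact: dterm_var|exact: dterm_dfun da (dterm_var 1)].
have [q q0 hq] := definable_const_off_roots2 (fun=> 0) dS.
exists q => // r; apply: contrapT => /eqP nz.
pose p := map_poly (horner_eval r) q.
have e x : q.[x%:P].[r] = p.[x].
  have := horner_map (horner_eval r) q x%:P.
  by rewrite /= /horner_eval hornerC.
have e0 : 0 < `|p.[a r]| by rewrite normr_gt0 -e.
have [d d0 hd] := @poly_cont _ (a r) p _ e0.
have : a r + d / 2 = a r.
  apply/(hq r (a r) (a r + d / 2)) => //=.
    by rewrite lerDl divr_ge0 // ltW.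
  move=> x /andP[ax xd]; rewrite e.
  have /hd : `|x - a r| < d by rewrite ger0_norm ?subr_ge0 //; lra.
  by apply: contraTneq => ->; rewrite sub0r normrN ltxx.
move=> /eqP; rewrite -subr_eq0 addrAC subrr add0r mulf_eq0 gt_eqF //=.
by rewrite invr_eq0 pnatr_eq0.
Qed.

Lemma dterm_horner (p : {poly R}) T : dterm T -> dterm (fun E => p.[T E]).
Proof.
move=> d; under eq_fun do rewrite horner_coef.
by apply: dterm_sum => i; apply: dtermM; [exact: dterm_const|exact: dtermX].
Qed.

Lemma horner2_coef (q : {poly {poly R}}) x y :
  q.[x%:P].[y] = \sum_(i < size q) (q`_i).[y] * x ^+ i.
Proof.
rewrite (horner_coef q) horner_sum; apply: eq_bigr => i _.
by rewrite hornerM horner_exp hornerC.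
Qed.

Lemma dterm_horner2 (q : {poly {poly R}}) T1 T2 : dterm T1 -> dterm T2 ->
  dterm (fun E => q.[(T1 E)%:P].[T2 E]).
Proof.
move=> d1 d2; under eq_fun do rewrite horner2_coef.
by apply: dterm_sum => i; apply: dtermM; [exact: dterm_horner|exact: dtermX].
Qed.

Lemma poly_near_neq0 (p : {poly R}) : p != 0 -> \forall r \near +oo, p.[r] != 0.
Proof.
move=> p0; exists (cauchy_bound p); split; first by rewrite num_real.
move=> r /= pr; have := ge_cauchy_bound p0 (x := r).
by rewrite in_itv /= (ltW pr) => /(_ isT); rewrite rootE.
Qed.

Lemma deriv_poly2_eq0 (q : {poly {poly R}}) : q^`() = 0 -> (size q <= 1)%N.
Proof.
move=> q'0; rewrite leqNgt; apply/negP => q1.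
have : (q^`())`_(size q).-2 = 0 by rewrite q'0 coef0.
have e : (size q).-2.+1 = (size q).-1 by case: (size q) q1 => [|[]].
rewrite coef_deriv e -mulr_natr => /eqP.
rewrite mulf_eq0 -[_`_ _]/(lead_coef q) lead_coef_eq0.
rewrite -polyC_natr polyC_eq0 pnatr_eq0 -size_poly_eq0.
by case: (size q) q1 => [|[]].
Qed.

(** As long as the derivative in the outer variable also vanishes along the graph for large r, it
    replaces the equation. The degree drops, and the process stops before degree 0, because a
    nonzero polynomial in r alone does not vanish for large r. *)
Lemma dfun_simple_root a : dfun a -> exists q : {poly {poly R}},
  (\forall r \near +oo, q.[(a r)%:P].[r] = 0) /\
  (\forall r \near +oo, q^`().[(a r)%:P].[r] != 0).
Proof.
move=> da; have [q0 q0n h0] := dfun_algebraic da.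
have {h0} h0 : \forall r \near +oo, q0.[(a r)%:P].[r] = 0 by near=> r.
have [n] := ubnP (size q0).
elim: n q0 q0n h0 => // n IHn q qn hq qs.
have d' : dset (fun r => q^`().[(a r)%:P].[r] = 0).
  apply: definable_eq; last exact: dterm_const.
  exact: dterm_horner2 da (dterm_var 0).
have [h|h] := dset_near d'; last first.
  by exists q; split=> //; near=> r; apply/eqP; near: r.
apply: (IHn q^`()) => //; last first.
  by rewrite -ltnS; apply: leq_trans qs; rewrite ltnS; exact: lt_size_deriv.
apply/eqP => /deriv_poly2_eq0 /size1_polyC e.
have c0 : q`_0 != 0 by rewrite -polyC_eq0 -e.
have [r [/= h1 /eqP]] := filter_ex (filterI hq (poly_near_neq0 c0)).
by rewrite -[q`_0](hornerC _ (a r)%:P) -e h1.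
Unshelve. all: by end_near. Qed.

(** The derivative by epsilon and delta, which makes the relation between [r] and [y] visibly
    first-order. *)
Definition hasder a r y := forall e, 0 < e -> exists2 d, 0 < d &
  forall s, `|s - r| < d -> `|a s - a r - y * (s - r)| <= e * `|s - r|.

Lemma hasderP a r y : hasder a r y <-> is_derive r 1 a y.
Proof.
split=> [h|[/[swap] <- dv] e e0].
  suff hl : (fun h => h^-1 *: ((a \o shift r) (h *: 1) - a r)) @ 0^' --> y.
    by split; [exact: cvgP hl|exact: cvg_lim hl].
  apply/cvgrPdist_le => e e0; have [d d0 hd] := h e e0.
  near=> x => /=.
  have x0 : x != 0 by near: x; exact: nbhs_dnbhs_neq.
  have := hd (x + r); rewrite addrK => hx.
  have {hx}/hx : `|x| < d by near: x; exact: dnbhs0_lt.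
  rewrite /GRing.scale /= mulr1 => hx.
  rewrite -(ler_pM2r (_ : 0 < `|x|)) ?normr_gt0 //; apply: le_trans hx.
  rewrite -normrM distrC mulrBl mulrAC mulVf // mul1r.
  by [].
move: dv => /cvgrPdist_le /(_ e e0).
rewrite near_withinE => /nbhs_ballP[d d0 hd]; exists d => // s sd.
have [->|sr] := eqVneq s r; first by rewrite !subrr mulr0 subrr normr0 mulr0.
have sr0 : s - r != 0 by rewrite subr_eq0.
have := hd (s - r); rewrite /ball /= sub0r normrN => /(_ sd sr0).
rewrite /GRing.scale /= mulr1 subrK => hx.
rewrite -(ler_pM2r (_ : 0 < `|s - r|)) ?normr_gt0 // in hx.
apply: le_trans hx; rewrite -normrM distrC mulrBl mulrAC mulVf // mul1r.
by [].
Unshelve. all: by end_near. Qed.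

Lemma definable_hasder a T1 T2 : dfun a -> dterm T1 -> dterm T2 ->
  definable (fun E => hasder a (T1 E) (T2 E)).
Proof.
move=> da d1 d2.
have D : definable (fun E => hasder a (E 1%N) (E 0%N)).
  apply: definable_forall; apply: definable_imp.
    exact: definable_lt (dterm_const 0) (dterm_var 0).
  apply: (@definable_ext _ (fun E => exists d, 0 < d /\
    forall s, `|s - E 2%N| < d ->
      `|a s - a (E 2%N) - E 1%N * (s - E 2%N)| <= E 0%N * `|s - E 2%N|)).
    by move=> E; split=> [[d []]|[d]]; exists d.
  apply: definable_exists; apply: definable_and.
    exact: definable_lt (dterm_const 0) (dterm_var 0).
  apply: definable_forall; apply: definable_imp => /=.
    apply: definable_lt; last exact: dterm_var.
    by apply: dterm_norm; apply: dtermB; exact: dterm_var.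
  apply: definable_le.
    apply: dterm_norm; apply: dtermB; last first.
      by apply: dtermM; [|apply: dtermB]; exact: dterm_var.
    by apply: dtermB; apply: dterm_dfun => //; exact: dterm_var.
  by apply: dtermM; [|apply: dterm_norm; apply: dtermB]; exact: dterm_var.
exact: (definable_let2 d1 d2 D).
Qed.

Lemma horner2_continuous (q : {poly {poly R}}) :
  continuous (fun z : R * R => q.[z.1%:P].[z.2]).
Proof.
elim/poly_ind: q => [|q c IHq] z.
  under eq_fun do rewrite horner0 horner0; exact: cvg_cst.
under [X in continuous_at _ X]eq_fun do rewrite !hornerE.
apply: cvgD.
  by apply: cvgM; [exact: IHq|exact: cvg_fst].
apply: (continuous_comp (f := snd) (g := horner c)); first exact: cvg_snd.
exact: continuous_horner.
Qed.

Lemma horner2_mvt (q : {poly {poly R}}) x x' y : exists2 xi,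
  Num.min x x' <= xi <= Num.max x x' &
  q.[x'%:P].[y] - q.[x%:P].[y] = q^`().[xi%:P].[y] * (x' - x).
Proof.
have e (p : {poly {poly R}}) z :
    p.[z%:P].[y] = (map_poly (horner_eval y) p).[z].
  have := horner_map (horner_eval y) p z%:P.
  by rewrite /= /horner_eval hornerC.
rewrite !e; have [xx|xx|->] := ltgtP x x'; last first.
- by exists x'; rewrite ?lexx // !subrr mulr0.
- have [c] := poly_mvt (map_poly (horner_eval y) q) xx.
  rewrite in_itv /= => /andP[c1 c2] h; exists c; first by rewrite !ltW.
  by rewrite e -[LHS]opprB h -mulrN opprB deriv_map.
- have [c] := poly_mvt (map_poly (horner_eval y) q) xx.
  rewrite in_itv /= => /andP[c1 c2] h; exists c; first by rewrite !ltW.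
  by rewrite e h deriv_map.
Qed.

End DefinableFunctions.

(** * Differentiability of definable functions *)

Section Derivatives.
Context {R : realType}.
Implicit Types (E : nat -> R) (S : (nat -> R) -> Prop) (T : (nat -> R) -> R).
Implicit Types (a b : R -> R) (A : R -> Prop).

Lemma itv_oo_uncountable (u v : R) : u < v -> ~ countable [set x | u < x < v].
Proof.
move=> uv /countable_lebesgue_measure0.
rewrite (_ : [set x | u < x < v] = [set` `]u, v[]).
  rewrite lebesgue_measure_itv /= lte_fin uv => /eqP.
  by rewrite EFinN -EFinD eqe subr_eq0 gt_eqF.
by apply/seteqP; split=> x; rewrite /= in_itv.
Qed.

Lemma between_dist (x x' z : R) : Num.min x x' <= z <= Num.max x x' ->
  `|z - x| <= `|x' - x| /\
  forall c k, `|x - c| < k -> `|x' - c| < k -> `|z - c| < k.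
Proof.
have [xx|xx] := lerP x x' => /andP[h1 h2]; split.
- by rewrite !ger0_norm; lra.
- by move=> c k; rewrite !ltr_distl => /andP[? ?] /andP[? ?]; apply/andP; lra.
- by rewrite !ler0_norm; lra.
- by move=> c k; rewrite !ltr_distl => /andP[? ?] /andP[? ?]; apply/andP; lra.
Qed.

(* Off its roots, [q^`()] is bounded below on a small box around the graph, and
   finitely many parameters describe countably many boxes: one of them captures
   uncountably many points of the graph, hence an interval of them. *)
Lemma dfun_derivable_point a (M : R) : dfun a ->
  exists2 r, M < r & exists y, hasder a r y.
Proof.
move=> da; have [q [[M1 [_ h0]] [M2 [_ h1]]]] := dfun_simple_root da.
pose M0 := Num.max M (Num.max M1 M2).
have hM0 r : M0 < r -> [/\ M < r, M1 < r & M2 < r].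
  by rewrite !gt_max => /andP[-> /andP[-> ->]].
pose k (m : nat) : R := m.+1%:R^-1.
have k0 m : 0 < k m by rewrite invr_gt0.
(* The box has a rational centre in the first variable but is centred at [r] itself in the second,
   so countably many pairs [md] are enough. *)
pose B (md : nat * rat) r := M0 < r /\ (r < M0 + 1 /\
  (`|a r - ratr md.2| < k md.1 /\ forall x, `|x - ratr md.2| < k md.1 ->
    forall y, `|y - r| < k md.1 -> k md.1 <= `|q^`().[x%:P].[y]|)).
have dB md : dset (B md).
  apply: definable_and.
    exact: definable_lt (dterm_const _) (dterm_var 0).
  apply: definable_and.
    exact: definable_lt (dterm_var 0) (dterm_const _).
  apply: definable_and.
    apply: definable_lt (dterm_const _); apply/dterm_norm/dtermB.
      exact: dterm_dfun da (dterm_var 0).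
    exact: dterm_const.
  apply: definable_forall => /=; apply: definable_imp.
    apply: definable_lt (dterm_const _); apply/dterm_norm/dtermB.
      exact: dterm_var.
    exact: dterm_const.
  apply: definable_forall => /=; apply: definable_imp.
    apply: definable_lt (dterm_const _).
    by apply/dterm_norm/dtermB; exact: dterm_var.
  apply: definable_le; first exact: dterm_const.
  by apply/dterm_norm/dterm_horner2; exact: dterm_var.
have cover (r : R) : M0 < r < M0 + 1 -> exists md, B md r.
  move=> /andP[r1 r2]; have [_ _ rM2] := hM0 _ r1.
  pose phi (z : R * R) := q^`().[z.1%:P].[z.2].
  have nz : 0 < `|phi (a r, r)| / 2.
    by rewrite divr_gt0 // normr_gt0; exact: h1.
  have := @horner2_continuous R q^`() (a r, r).
  rewrite /continuous_at -/phi => /cvgrPdist_lt/(_ _ nz).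
  move=> /nbhs_ballP[e e0 he].
  (* The rational centre will lie within [k m] of [a r], so the points of the box are within [2 k m]
     of it. *)
  have [m hm] : exists m, k m + k m < e /\ k m < `|phi (a r, r)| / 2.
    near \oo => m; exists m; split.
      rewrite -mulr2n -mulr_natr -ltr_pdivlMr //.
      by near: m; apply: near_infty_natSinv_lt (PosNum _); rewrite divr_gt0.
    by near: m; exact: near_infty_natSinv_lt (PosNum nz).
  have [d] : exists d : rat, ratr d \in `]a r - k m, a r + k m[.
    by apply: rat_in_itvoo; have := k0 m; lra.
  rewrite in_itv /= => /andP[d1 d2].
  exists (m, d); do !split => //=.
    by rewrite ltr_distl; apply/andP; split; lra.
  move=> x hx y hy.
  have : `|phi (a r, r) - phi (x, y)| < `|phi (a r, r)| / 2.
    apply: he; split => /=; rewrite /ball /= distrC; last first.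
      by apply: lt_trans hy _; have := k0 m; lra.
    have -> : x - a r = (x - ratr d) + (ratr d - a r) by ring.
    apply: le_lt_trans (ler_normD _ _) _.
    apply: lt_trans hm.1; apply: ltrD => //.
    by rewrite ltr_norml; apply/andP; split; lra.
  move=> h; apply/ltW/(lt_trans hm.2).
  have := ler_normD (phi (a r, r) - phi (x, y)) (phi (x, y)).
  rewrite subrK /phi /= in h *; lra.
have [md hmd] : exists md, ~ countable [set r | B md r].
  apply: contrapT => /forallNP hall.
  apply: (@itv_oo_uncountable M0 (M0 + 1)); first by rewrite ltrDl.
  apply: (@sub_countable _ _ _ (\bigcup_(md in setT) [set r | B md r])).
    by apply: subset_card_le => r /cover[md Bmd]; exists md.
  by apply: bigcup_countable => // md _; exact: contrapT (hall md).
have [u [v [uv huv]]] := definable_uncountable (dB md) (E := fun=> 0) hmd.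
have {}huv r : u < r < v -> B md r by exact: huv.
set K := k md.1 in huv *; have K0 : 0 < K by exact: k0.
pose r := (u + v) / 2.
have ruv : u < r < v by rewrite /r; apply/andP; split; lra.
have [rM0 [_ [ad hB]]] := huv r ruv.
have [rM rM1 rM2] := hM0 _ rM0.
exists r => //.
pose psi := q.[(a r)%:P].
(* [q] vanishes at (a r, r) and (a s, s), and [psi s] is its value at (a r, s). The mean value
   theorem in the first variable, at height [s], links [psi] to the increment of [a]. *)
have mvt s : exists xi, `|s - r| < K -> u < s < v ->
    [/\ `|xi - a r| <= `|a s - a r|, K <= `|q^`().[xi%:P].[s]| &
      psi.[r] - psi.[s] = q^`().[xi%:P].[s] * (a s - a r)].
  have [xi hxi e] := horner2_mvt q (a r) (a s) s; exists xi => sr suv.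
  have [sM0 [_ [sd _]]] := huv s suv; have [_ sM1 _] := hM0 _ sM0.
  move: e; rewrite h0 // sub0r => e.
  have [h2 h3] := between_dist hxi.
  by split; [|apply: hB => //; exact: h3|rewrite -e /psi h0 // sub0r].
pose xi s := projT1 (cid (mvt s)).
have hxi : \forall s \near r, [/\ `|xi s - a r| <= `|a s - a r|,
   K <= `|q^`().[(xi s)%:P].[s]| &
      psi.[r] - psi.[s] = q^`().[(xi s)%:P].[s] * (a s - a r)].
  near=> s; apply: (projT2 (cid (mvt s))).
    by rewrite distrC; near: s; exact: nbhsx_ballx.
  apply/andP; split; near: s.
    by apply: lt_nbhsr; case/andP: ruv.
  by apply: lt_nbhsl; case/andP: ruv.
(* Dividing by a partial derivative of modulus at least [K] turns the continuity of [psi] into that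
   of [a], which was not known so far. *)
have acvg : a s @[s --> r] --> a r.
  apply/cvgrPdist_le => e e0; near=> s.
  have [_ h2 h3] : [/\ `|xi s - a r| <= `|a s - a r|,
     K <= `|q^`().[(xi s)%:P].[s]| &
      psi.[r] - psi.[s] = q^`().[(xi s)%:P].[s] * (a s - a r)] by near: s.
  rewrite distrC -(ler_pM2l K0).
  apply: le_trans (_ : `|psi.[r] - psi.[s]| <= _).
    by rewrite h3 normrM ler_wpM2r.
  near: s; have := @continuous_horner _ psi r.
  by move=> /cvgrPdist_le; apply; rewrite mulr_gt0.
have xicvg : xi s @[s --> r] --> a r.
  apply/cvgrPdist_le => e e0; near=> s.
  rewrite distrC; apply: (@le_trans _ _ `|a s - a r|).
    by near: s; apply: filterS hxi => s [].
  by rewrite distrC; near: s; move/cvgrPdist_le: acvg; exact.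
pose D s := q^`().[(xi s)%:P].[s].
have Dcvg : D s @[s --> r] --> q^`().[(a r)%:P].[r].
  apply: (@continuous2_cvg _ _ _ _ _ _ xi id
           (fun x y => q^`().[x%:P].[y]) (a r) r) => //.
  exact: (@horner2_continuous R q^`() (a r, r)).
(* The increment of [psi] is [psi1 s * (s - r)], so the difference quotient of [a] is
   [- psi1 s / D s]; in the limit this is the formula of the implicit function theorem. *)
have /factor_theorem[psi1 epsi] : root (psi - psi.[r]%:P) r.
  by rewrite rootE !hornerE subrr.
pose y := - psi1.[r] * (q^`().[(a r)%:P].[r])^-1.
exists y => e e0.
have : - psi1.[s] * (D s)^-1 @[s --> r] --> y.
  apply: cvgM; first by apply: cvgN; exact: continuous_horner.
  by apply: cvgV => //; exact: h1.
move=> /cvgrPdist_le/(_ e e0)/(filterI hxi)/nbhs_ballP[d d0 hd].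
exists d => // s; rewrite distrC => /hd[[_ Ks h3]] hs.
have Ds0 : D s != 0 by rewrite -normr_gt0; exact: lt_le_trans Ks.
have e1 : psi.[s] - psi.[r] = psi1.[s] * (s - r).
  by move: (congr1 (horner^~ s) epsi); rewrite !hornerE.
have -> : a s - a r = - psi1.[s] * (D s)^-1 * (s - r).
  apply: (mulfI Ds0); rewrite -h3 -opprB e1 /D; field.
  exact: Ds0.
by rewrite -mulrBl normrM (distrC r s) ler_wpM2r // distrC.
Unshelve. all: by end_near. Qed.

(** The set of points of derivability is definable and meets every neighbourhood of infinity, hence
    contains one. Definable choice in the relation [hasder] makes the derivative a definable
    function, so that tameness applies to it in turn. *)
Lemma dfun_derive a : dfun a -> exists2 b, dfun b &
  \forall r \near +oo, is_derive (r : R) (1 : R) a (b r).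
Proof.
move=> da.
have dS : definable (fun E => hasder a (E 1%N) (E 0%N)).
  exact: definable_hasder da (dterm_var 1) (dterm_var 0).
have [c dc hc] := definable_choice dS.
exists (fun r => c (r .: fun=> 0)); first exact: dfun_dterm.
have : \forall r \near +oo, exists y, hasder a r y.
  apply: dset_frequently; first exact: (definable_ex dS).
  by move=> M; exact: dfun_derivable_point.
by apply: filterS => r ex; apply/hasderP; exact: (hc (r .: fun=> 0)).
Qed.

End Derivatives.

(** * Growth of definable functions *)

Section Asymptotics.
Context {R : realType}.
Implicit Types (a b u v : R -> R) (A : R -> Prop).

Lemma near_pinfty_pos A : (\forall r \near +oo, A r) ->
  exists2 M, 0 < M & forall r, M <= r -> A r.
Proof.
move=> [M [_ hM]]; exists (Num.max M 0 + 1).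
  by rewrite ltr_wpDl // le_max lexx orbT.
by move=> r Mr; apply: hM; rewrite (lt_le_trans _ Mr) // ltr_pwDr // le_max lexx.
Qed.

Lemma is_derive_le (f df : R -> R) (x y : R) : x <= y ->
  (forall z, x <= z <= y -> is_derive z 1 f (df z)) ->
  (forall z, x <= z <= y -> 0 <= df z) -> f x <= f y.
Proof.
rewrite le_eqVlt => /predU1P[-> //|xy] hd hp.
have [z|| c] := @MVT R f df x y xy.
- by rewrite in_itv /= => /andP[? ?]; apply: hd; rewrite !ltW.
- apply: derivable_within_continuous => z; rewrite in_itv /= => hz.
  by have [] := hd z hz.
- rewrite in_itv /= => /andP[xc cy] h.
  by rewrite -subr_ge0 h mulr_ge0 ?subr_ge0 ?hp ?ltW // xc cy.
Qed.

Lemma ln_diff_bound (f df : R -> R) (e M C : R) : 0 < e -> 0 < M ->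
  (forall z, M <= z -> is_derive z 1 f (df z)) ->
  (forall z, M <= z -> e < z * df z) ->
  ~ (forall z, M <= z -> `|f z| <= C).
Proof.
move=> e0 M0 hd he hC.
have C0 : 0 <= C by apply: le_trans (hC M (lexx M)).
(* Chosen so that [e * ln (r / M)] is [2 * C + 1], more than the variation [2 * C] that the bound on
   [f] permits. *)
pose r := M * expR ((2 * C + 1) / e).
have r1 : 1 <= expR ((2 * C + 1) / e).
  by apply: le_trans (expR_ge1Dx _); rewrite lerDl divr_ge0 ?(ltW e0) //; lra.
have Mr : M <= r by rewrite /r ler_peMr // ltW.
have pos z : M <= z -> 0 < z by exact: lt_le_trans.
have : f M - e * ln M <= f r - e * ln r.
  apply: (@is_derive_le (fun z => f z - e * ln z)
    (fun z => df z - e * z^-1)) => //.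
    move=> z /andP[Mz _]; apply: is_deriveB; first exact: hd.
    exact: (is_deriveZ e (is_derive1_ln (pos z Mz))).
  move=> z /andP[Mz _]; rewrite subr_ge0 ler_pdivrMr ?pos // mulrC ltW //.
  exact: he.
rewrite /r lnM ?posrE ?expR_gt0 // expRK mulrDr mulrC mulrC.
have := hC M (lexx M); have := hC r Mr; rewrite !ler_norml /r.
have -> : e * ((2 * C + 1) / e) = 2 * C + 1 by rewrite mulrC divfK // gt_eqF.
move=> /andP[? ?] /andP[? ?]; lra.
Qed.

(* Were [r * b r] bounded away from [0], [a] would grow at least like [ln]. *)
Lemma dfun_bounded_derive a b (C : R) : dfun b ->
  (\forall r \near +oo, is_derive (r : R) (1 : R) a (b r)) ->
  (\forall r \near +oo, `|a r| <= C) ->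
  forall e, 0 < e -> \forall r \near +oo, `|r * b r| <= e.
Proof.
move=> db hab hC e e0.
have one (a' b' : R -> R) : dfun b' ->
    (\forall r \near +oo, is_derive (r : R) (1 : R) a' (b' r)) ->
    (\forall r \near +oo, `|a' r| <= C) -> \forall r \near +oo, r * b' r <= e.
  move=> db' h1 h2.
  have dA : dset (fun r => r * b' r <= e).
    by apply: definable_le (dterm_const e); apply: dtermM db'; exact: dterm_var.
  have [//|h3] := dset_near dA; exfalso.
  have [M M0 hM] := near_pinfty_pos (filterI (filterI h1 h2) h3).
  apply: (@ln_diff_bound a' b' e M C) => // z /hM [[hz1 hz2] hz3] //.
  by rewrite ltNge; apply/negP.
have h1 := one a b db hab hC.
have h2 : \forall r \near +oo, r * - b r <= e.
  apply: (one (fun r => - a r) (fun r => - b r)); first exact: dtermN.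
    by apply: filterS hab => r hr; exact: is_deriveN.
  by apply: filterS hC => r; rewrite normrN.
apply: filterS (filterI h1 h2) => r [hr1 hr2].
by rewrite ler_norml hr1 andbT lerNl -mulrN.
Qed.

(** The quotient of the coordinate of smaller modulus by the other is bounded by 1, and which is
    which is settled for all large r by the dichotomy. Multiplying its derivative by the square of
    the denominator gives the claim. *)
Lemma dfun_no_spiral a b a' b' (e : R) :
  dfun a -> dfun b -> dfun a' -> dfun b' ->
  (\forall r \near +oo, is_derive (r : R) (1 : R) a (a' r)) ->
  (\forall r \near +oo, is_derive (r : R) (1 : R) b (b' r)) -> 0 < e ->
  \forall r \near +oo,
    `|r * (a r * b' r - b r * a' r)| <= e * (a r ^+ 2 + b r ^+ 2).
Proof.
move=> da db da' db' ha hb e0.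
have one (a1 b1 a1' b1' : R -> R) :
    dfun a1 -> dfun b1 -> dfun a1' -> dfun b1' ->
    (\forall r \near +oo, is_derive (r : R) (1 : R) a1 (a1' r)) ->
    (\forall r \near +oo, is_derive (r : R) (1 : R) b1 (b1' r)) ->
    (\forall r \near +oo, `|b1 r| <= `|a1 r|) ->
    \forall r \near +oo,
      `|r * (a1 r * b1' r - b1 r * a1' r)| <= e * (a1 r ^+ 2 + b1 r ^+ 2).
  move=> d1 d2 d3 d4 h1 h2 h3.
  have : dset (fun r => a1 r = 0) by exact: definable_eq d1 (dterm_const 0).
  (* If the dominating coordinate is eventually 0, so is the other, and both sides vanish. *)
  move=> /dset_near[h4|h4].
    apply: filterS (filterI h3 h4) => r [+ ar].
    rewrite ar normr0 normr_le0 => /eqP ->.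
    by rewrite !mul0r subrr mulr0 normr0 expr0n /= addr0 mulr0.
  pose q r := b1 r * (a1 r)^-1.
  pose q' r := (a1 r * b1' r - b1 r * a1' r) * (a1 r ^+ 2)^-1.
  have dq' : dfun q'.
    apply: dtermM; last by apply: dtermV; exact: dtermX.
    by apply: dtermB; exact: dtermM.
  have hq : \forall r \near +oo, is_derive (r : R) (1 : R) q (q' r).
    apply: filterS (filterI (filterI h1 h2) h4) => r [[hr1 hr2] /eqP hr3].
    apply: (is_derive_eq (is_deriveM hr2 (is_deriveV hr3 hr1))).
    rewrite /q' /GRing.scale /=.
    by field.
  have q1 : \forall r \near +oo, `|q r| <= 1.
    apply: filterS (filterI h3 h4) => r [hr1 /eqP hr2].
    by rewrite /q normrM normfV ler_pdivrMr ?normr_gt0 // mul1r.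
  have := dfun_bounded_derive dq' hq q1 e0.
  move=> h5; apply: filterS (filterI h5 h4) => r [+ /eqP ar].
  have a2 : 0 < a1 r ^+ 2 by rewrite exprn_even_gt0.
  rewrite /q' mulrA normrM normfV [`|a1 r ^+ 2|]gtr0_norm // ler_pdivrMr //.
  move=> /le_trans; apply.
  by rewrite ler_wpM2l ?(ltW e0) // lerDl sqr_ge0.
have dab : dset (fun r => `|b r| <= `|a r|).
  exact: definable_le (dterm_norm db) (dterm_norm da).
have [h|h] := dset_near dab; first exact: (one a b a' b').
have := one b a b' a' db da db' da' hb ha.
have h' : \forall r \near +oo, `|a r| <= `|b r|.
  by apply: filterS h => r /negP; rewrite -ltNge; exact: ltW.
move=> /(_ h'); apply: filterS => r.
by rewrite -opprB mulrN normrN [b r ^+ 2 + _]addrC.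
Qed.

(** * Polynomial lower bounds for unbounded definable functions *)

Lemma poly_seq_growth (s : seq {poly R}) : exists C K, 0 <= C /\
  forall y, 1 <= y -> \sum_(p <- s) `|p.[y]| <= C * y ^+ K.
Proof.
elim: s => [|p s [C [K [C0 hC]]]].
  by exists 0, 0%N; split=> // y _; rewrite big_nil mul0r.
pose D := \sum_(i < size p) `|p`_i|.
have D0 : 0 <= D by exact: sumr_ge0.
exists (D + C), (size p + K)%N; split; first exact: addr_ge0.
move=> y y1; rewrite big_cons mulrDl; apply: lerD; last first.
  apply: (le_trans (hC y y1)); rewrite ler_wpM2l //.
  by rewrite ler_weXn2l // leq_addl.
rewrite horner_coef; apply: (le_trans (ler_norm_sum _ _ _)).
rewrite mulr_suml; apply: ler_sum => i _; rewrite normrM ler_wpM2l //.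
rewrite ger0_norm ?exprn_ge0 ?(le_trans ler01) // ler_weXn2l //.
by rewrite (leq_trans (ltnW (ltn_ord i))) // leq_addr.
Qed.

Lemma poly_near_ge_lead (p : {poly R}) : p != 0 ->
  exists n : R, forall y, n <= y -> `|lead_coef p| <= `|p.[y]|.
Proof.
move=> p0; have [l0|l0|/eqP] := ltgtP (lead_coef p) 0; last first.
- by rewrite lead_coef_eq0 (negPf p0).
- have [n hn] := poly_pinfty_gt_lc l0; exists n => y /hn h.
  by rewrite !gtr0_norm // (lt_le_trans l0).
- have l0' : 0 < lead_coef (- p) by rewrite lead_coefN oppr_gt0.
  have [n hn] := poly_pinfty_gt_lc l0'; exists n => y /hn h.
  by rewrite -normrN -lead_coefN -[`|p.[y]|]normrN -hornerN !gtr0_norm //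
    (lt_le_trans l0').
Qed.

(* The equation satisfied by [a] is read as one for [r] with coefficients
   polynomial in [a r]. *)
Lemma dfun_pinfty_growth a : dfun a ->
  (forall M : R, \forall r \near +oo, M < a r) ->
  exists (C : R) K, 0 < C /\ \forall r \near +oo, r <= C * a r ^+ K.
Proof.
move=> da ainf; have [q q0 hq] := dfun_algebraic da.
pose Q := swapXY q; have Q0 : Q != 0 by rewrite swapXY_eq0.
have lQ0 : lead_coef Q != 0 by rewrite lead_coef_eq0.
have [n hn] := poly_near_ge_lead lQ0.
set l := `|lead_coef _| in hn.
have l0 : 0 < l by rewrite normr_gt0 !lead_coef_eq0.
have [C [K [C0 hC]]] := poly_seq_growth Q.
(* This is the Cauchy bound for the root r: [l] bounds the leading coefficient from below, and
   [C * a r ^+ K] bounds the sum of all coefficients from above. *)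
exists (1 + l^-1 * C), K; split.
  by rewrite ltr_pwDl // mulr_ge0 // invr_ge0 ltW.
apply: filterS (filterI (ainf n) (ainf 1)) => r [/ltW an /ltW a1].
pose p := map_poly (horner_eval (a r)) Q.
have lc : horner_eval (a r) (lead_coef Q) != 0.
  by rewrite -normr_gt0; apply: lt_le_trans (hn _ an).
have pr : p.[r] = 0.
  have := horner_map (horner_eval (a r)) Q r%:P.
  by rewrite /= /horner_eval hornerC /p horner2_swapXY hq => ->.
have p0 : p != 0 by rewrite map_poly_eq0_id0.
have := cauchy_boundP p0 pr; rewrite /cauchy_bound => /(le_lt_trans (ler_norm r)).
move=> /ltW /le_trans; apply.
have ak : 1 <= a r ^+ K by rewrite exprn_ege1.
rewrite mulrDl mul1r; apply: lerD => //.
rewrite lead_coef_map_id0 ?rmorph0 // -mulrA; apply: ler_pM.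
- by rewrite invr_ge0.
- exact: sumr_ge0.
- by rewrite lef_pV2 ?posrE ?normr_gt0 ?lead_coef_eq0 //; exact: hn _ an.
apply: le_trans (hC _ a1); rewrite size_map_poly_id0 //.
rewrite (big_nth 0) big_mkord; apply: ler_sum => i _.
by rewrite coef_map.
Qed.

(** With e = 1 / (K + 1) the function a^(K+1) / r is eventually nonincreasing, so a^(K+1) <= B r.
    The growth bound r <= C a^K then gives a <= B C, against divergence. *)
Lemma dfun_subpoly_false a b : dfun a ->
  (forall M : R, \forall r \near +oo, M < a r) ->
  (\forall r \near +oo, is_derive (r : R) (1 : R) a (b r)) ->
  ~ (forall e : R, 0 < e -> \forall r \near +oo, r * b r <= e * a r).
Proof.
move=> da ainf hd hs.
have [C [K [C0 hC]]] := dfun_pinfty_growth da ainf.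
have k0 : (0 : R) < K.+1%:R^-1 by rewrite invr_gt0.
have [M M0 hM] := near_pinfty_pos (filterI (filterI (ainf 0) hd) (hs _ k0)).
pose B := a M ^+ K.+1 * M^-1.
have hB r : M <= r -> a r ^+ K.+1 <= B * r.
  move=> Mr; have r0 := lt_le_trans M0 Mr.
  rewrite -ler_pdivrMr // -lerN2 /B.
  apply: (@is_derive_le (fun z => - (a z ^+ K.+1 * z^-1))
    (fun z => - (a z ^+ K * (K.+1%:R * b z * z - a z) * z ^- 2))) => //.
    move=> z /andP[Mz _]; have z0 := lt_le_trans M0 Mz.
    have [[_ hz] _] := hM z Mz.
    have zn0 : z != 0 by rewrite gt_eqF.
    have hX := is_deriveX K.+1 hz; rewrite exprfctE in hX.
    apply: (is_derive_eq (is_deriveN (is_deriveM hX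
      (is_deriveV (f := id) zn0 (is_derive_id z 1))))).
    rewrite /GRing.scale /= exprS.
    by field.
  move=> z /andP[Mz _]; have z0 := lt_le_trans M0 Mz.
  have [[az _] hz] := hM z Mz.
  rewrite oppr_ge0 mulr_le0_ge0 ?invr_ge0 ?exprn_ge0 ?(ltW z0) //.
  rewrite mulr_ge0_le0 ?exprn_ge0 ?(ltW az) // subr_le0.
  by rewrite -mulrA [b z * z]mulrC -ler_pdivlMl // .
have [r [/= [Mr r1] [r2 r3]]] := filter_ex (filterI (filterI
  (nbhs_pinfty_ge (num_real M)) (ainf 0)) (filterI hC (ainf (B * C)))).
have B0 : 0 <= B.
  have [[aM _] _] := hM M (lexx M).
  by rewrite mulr_ge0 ?exprn_ge0 ?invr_ge0 ?ltW.
have := le_trans (hB r Mr) (ler_wpM2l B0 r2).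
rewrite exprS mulrA ler_pM2r ?exprn_gt0 //.
by rewrite leNgt r3.
Qed.

(** The limit is the lower limit, the supremum of the eventual lower bounds. By the dichotomy, if
    [a] did not eventually stay below [sup A + e], this number would be an eventual lower bound
    itself. *)
Lemma dfun_bounded_cvg a (C : R) : dfun a ->
  (\forall r \near +oo, `|a r| <= C) ->
  exists l : R, a r @[r --> +oo] --> l.
Proof.
move=> da hC; pose A := [set c : R | \forall r \near +oo, c <= a r].
have A0 : A !=set0.
  by exists (- C); apply: filterS hC => r; rewrite ler_norml => /andP[].
have Aub : has_ubound A.
  exists C => c hc; have [r [/= h1]] := filter_ex (filterI hc hC).
  by rewrite ler_norml => /andP[_]; exact: le_trans.
exists (sup A); apply/cvgrPdist_le => e e0.
have [c Ac hc] := sup_adherent e0 (conj A0 Aub).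
have : dset (fun r => sup A + e <= a r).
  exact: definable_le (dterm_const _) da.
move=> /dset_near[h|h].
  have := sup_upper_bound (conj A0 Aub) h.
  by rewrite gerDl leNgt e0.
apply: filterS (filterI Ac h) => r [h1 /negP]; rewrite -ltNge => h2.
by rewrite ler_distl; apply/andP; split; lra.
Qed.

End Asymptotics.

(** * Differentials of complex polynomials and quotients *)

Section ComplexDifferentials.
Context {R : realType}.
Local Notation Re := complex.Re.
Local Notation Im := complex.Im.

Lemma ReM (z w : R[i]) : Re (z * w) = Re z * Re w - Im z * Im w.
Proof. by case: z w => [a b] [c d]. Qed.

Lemma ImM (z w : R[i]) : Im (z * w) = Re z * Im w + Im z * Re w.
Proof. by case: z w => [a b] [c d]. Qed.

Lemma ReD (z w : R[i]) : Re (z + w) = Re z + Re w.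
Proof. by case: z w => [a b] [c d]. Qed.

Lemma ImD (z w : R[i]) : Im (z + w) = Im z + Im w.
Proof. by case: z w => [a b] [c d]. Qed.

Lemma ReN (z : R[i]) : Re (- z) = - Re z.
Proof. by case: z. Qed.

Lemma ImN (z : R[i]) : Im (- z) = - Im z.
Proof. by case: z. Qed.

Lemma Re_conj (z : R[i]) : Re (conjc z) = Re z.
Proof. by case: z. Qed.

Lemma Im_conj (z : R[i]) : Im (conjc z) = - Im z.
Proof. by case: z. Qed.

Lemma ReV (z : R[i]) : Re z^-1 = Re z * (Re z ^+ 2 + Im z ^+ 2)^-1.
Proof. by case: z. Qed.

Lemma ImV (z : R[i]) : Im z^-1 = - Im z * (Re z ^+ 2 + Im z ^+ 2)^-1.
Proof. by case: z => a b; rewrite /GRing.inv /= mulNr. Qed.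

Lemma Re_sum (I : Type) (s : seq I) (F : I -> R[i]) :
  Re (\sum_(i <- s) F i) = \sum_(i <- s) Re (F i).
Proof. by elim: s => [|i s IHs]; rewrite ?big_nil // !big_cons ReD IHs. Qed.

Lemma Im_sum (I : Type) (s : seq I) (F : I -> R[i]) :
  Im (\sum_(i <- s) F i) = \sum_(i <- s) Im (F i).
Proof. by elim: s => [|i s IHs]; rewrite ?big_nil // !big_cons ImD IHs. Qed.

Lemma complexP (z w : R[i]) : Re z = Re w -> Im z = Im w -> z = w.
Proof. by case: z w => [a b] [c d] /= -> ->. Qed.

Lemma modulus2_gt0 (z : R[i]) : z != 0 -> 0 < Re z ^+ 2 + Im z ^+ 2.
Proof.
move=> z0; rewrite lt_def addr_ge0 ?sqr_ge0 // andbT.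
rewrite paddr_eq0 ?sqr_ge0 // !sqrf_eq0.
by move: z0; case: z => a b; rewrite eq_complex.
Qed.

Lemma mpoly_ring_ind (n : nat) (P : mpoly.mpoly n R[i] -> Prop) :
  (forall c, P (mpoly.mpolyC n c)) ->
  (forall j, P (mpoly.mpolyX R[i] (mpoly.mnm1 j))) ->
  (forall p q, P p -> P q -> P (p + q)) ->
  (forall p q, P p -> P q -> P (p * q)) -> forall p, P p.
Proof.
move=> hC hX hD hM; elim/mpoly.mpolyind => [|c m p _ _ hp].
  by rewrite -(mpoly.mpolyC0 n); exact: hC.
apply: (hD) => //; rewrite -mpoly.mul_mpolyC; apply: (hM); first exact: hC.
rewrite mpoly.mpolyXE_id; elim/big_rec: _ => [|j q _ hq].
  by rewrite -(mpoly.mpolyC1 n); exact: hC.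
apply: (hM) => //; elim: (m j) => [|k IHk].
  by rewrite expr0 -(mpoly.mpolyC1 n); exact: hC.
by rewrite exprS; exact: hM.
Qed.

Section Cdiff.
Context {V : normedModType R}.
Implicit Types (F G L : V -> R[i]) (x v : V).

(** Differentiability over the reals, so that conjugation is covered; the differential is kept
    complex-valued in order to state the product and quotient rules in complex form. *)
Definition cdiff F x L := is_diff x (fun y => Re (F y)) (fun v => Re (L v)) /\
  is_diff x (fun y => Im (F y)) (fun v => Im (L v)).

Lemma cdiff_eq F x L L' : cdiff F x L -> L =1 L' -> cdiff F x L'.
Proof. by move=> h /funext <-. Qed.

Lemma cdiff_cst c x : cdiff (fun=> c) x (fun=> 0).
Proof. by split; exact: is_diff_cst. Qed.

Lemma cdiffD F G x L L' : cdiff F x L -> cdiff G x L' ->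
  cdiff (fun y => F y + G y) x (fun v => L v + L' v).
Proof.
move=> [h1 h2] [h3 h4]; split.
  under eq_fun do rewrite ReD.
  by apply: is_diff_eq; apply/funext => v; rewrite ReD.
under eq_fun do rewrite ImD.
by apply: is_diff_eq; apply/funext => v; rewrite ImD.
Qed.

Lemma cdiffM F G x L L' : cdiff F x L -> cdiff G x L' ->
  cdiff (fun y => F y * G y) x (fun v => L v * G x + F x * L' v).
Proof.
move=> [h1 h2] [h3 h4]; split.
  under eq_fun do rewrite ReM.
  apply: (is_diff_eq (is_diffB (is_diffM h1 h3) (is_diffM h2 h4))).
  by apply/funext => v; rewrite ReD !ReM !fctE /GRing.scale /=; ring.
under eq_fun do rewrite ImM.
apply: (is_diff_eq (is_diffD (is_diffM h1 h4) (is_diffM h2 h3))).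
by apply/funext => v; rewrite ImD !ImM !fctE /GRing.scale /=; ring.
Qed.

Lemma cdiff_conj F x L : cdiff F x L ->
  cdiff (fun y => conjc (F y)) x (fun v => conjc (L v)).
Proof.
move=> [h1 h2]; split.
  under eq_fun do rewrite Re_conj.
  by apply: is_diff_eq; apply/funext => v; rewrite Re_conj.
under eq_fun do rewrite Im_conj.
by apply: (is_diff_eq (is_diffN h2)); apply/funext => v; rewrite Im_conj.
Qed.

End Cdiff.

Lemma is_derive_diff (f : R -> R) (t d : R) :
  is_derive t 1 f d -> is_diff t f (fun h => h * d).
Proof.
move=> [hd <-]; have df : differentiable f t by exact/derivable1_diffP.
split=> //; rewrite diff1E // derive1E.
by [].
Qed.

Section CdiffQuotient.
Context {V : normedModType R}.
Implicit Types (F G L : V -> R[i]) (x v : V).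

Lemma is_diff_modulus2 F x L : cdiff F x L ->
  is_diff x (fun y => Re (F y) ^+ 2 + Im (F y) ^+ 2)
    (fun v => 2 * (Re (F x) * Re (L v) + Im (F x) * Im (L v))).
Proof.
move=> [h1 h2].
apply: (is_diff_eq (is_diffD (is_diffM h1 h1) (is_diffM h2 h2))).
by apply/funext => v; rewrite !fctE /GRing.scale /=; ring.
Qed.

Lemma is_diff_scal (phi : R -> R) (f df : V -> R) x (d : R) :
  is_diff x f df -> is_derive (f x) 1 phi d ->
  is_diff x (fun y => phi (f y)) (fun v => df v * d).
Proof. by move=> h1 /is_derive_diff h2; exact: (is_diff_comp h1 h2). Qed.

Lemma cdiffV F x L : F x != 0 -> cdiff F x L ->
  cdiff (fun y => (F y)^-1) x (fun v => - L v * (F x)^-1 ^+ 2).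
Proof.
move=> Fx0 h; have [h1 h2] := h; have N0 := modulus2_gt0 Fx0.
have hN := is_diff_modulus2 h.
have N0' : Re (F x) ^+ 2 + Im (F x) ^+ 2 != 0 by rewrite gt_eqF.
have hV := is_diff_scal hN (is_deriveV (f := id) N0' (is_derive_id _ _)).
split.
  under eq_fun do rewrite ReV.
  apply: (is_diff_eq (is_diffM h1 hV)).
  apply/funext => v; rewrite !fctE /GRing.scale /= expr2.
  rewrite !(ReM, ImM, ReV, ImV, ReN, ImN).
  by field.
under eq_fun do rewrite ImV.
apply: (is_diff_eq (is_diffM (is_diffN h2) hV)).
apply/funext => v; rewrite !fctE /GRing.scale /= expr2.
rewrite !(ReM, ImM, ReV, ImV, ReN, ImN).
by field.
Qed.

(** The arguments [X j] are arbitrary differentiable functions: they will be the coordinates of a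
    point, and later the coordinates of a curve. *)
Lemma cdiff_meval n (X dX : 'I_n -> V -> R[i]) x (p : mpoly.mpoly n R[i]) :
  (forall j, cdiff (X j) x (dX j)) ->
  cdiff (fun y => mpoly.meval (X^~ y) p) x
    (fun v => \sum_j mpoly.meval (X^~ x) (mpoly.mderiv j p) * dX j v).
Proof.
move=> hX; elim/mpoly_ring_ind: p => [c|k|p q hp hq|p q hp hq].
- under eq_fun do rewrite mpoly.mevalC.
  apply: cdiff_eq (cdiff_cst c x) _ => v; rewrite big1 // => j _.
  by rewrite mpoly.mderivC mpoly.meval0 mul0r.
- under eq_fun do rewrite mpoly.mevalXU.
  apply: cdiff_eq (hX k) _ => v; rewrite (bigD1 k) //= big1 => [|j jk].
    rewrite mpoly.mderivX mpoly.mnm1E eqxx scale1r addr0.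
    rewrite (_ : mpoly.mnm_sub _ _ = mpoly.mnm0).
      by rewrite mpoly.mpolyX0 mpoly.meval1 mul1r.
    by apply/mpoly.mnmP => i; rewrite mpoly.mnmBE subnn mpoly.mnm0E.
  rewrite mpoly.mderivX mpoly.mnm1E eq_sym (negPf jk) scale0r.
  by rewrite mpoly.meval0 mul0r.
- under eq_fun do rewrite mpoly.mevalD.
  apply: cdiff_eq (cdiffD hp hq) _ => v; rewrite -big_split /=.
  by apply: eq_bigr => j _; rewrite mpoly.mderivD mpoly.mevalD mulrDl.
- under eq_fun do rewrite mpoly.mevalM.
  apply: cdiff_eq (cdiffM hp hq) _ => v.
  rewrite mulr_suml mulr_sumr -big_split /=; apply: eq_bigr => j _.
  by rewrite mpoly.mderivM mpoly.mevalD !mpoly.mevalM mulrDl mulrAC mulrA.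
Qed.

(** The j-th complex partial derivative of log (g / h), written without a branch of the
    logarithm. *)
Definition dlog n (g h : mpoly.mpoly n R[i]) (z : 'I_n -> R[i]) j : R[i] :=
  mpoly.meval z (mpoly.mderiv j g) / mpoly.meval z g -
  mpoly.meval z (mpoly.mderiv j h) / mpoly.meval z h.

Lemma cdiff_quot n (X dX : 'I_n -> V -> R[i]) x (g h : mpoly.mpoly n R[i]) :
  (forall j, cdiff (X j) x (dX j)) ->
  mpoly.meval (X^~ x) g != 0 -> mpoly.meval (X^~ x) h != 0 ->
  cdiff (fun y => mpoly.meval (X^~ y) g / mpoly.meval (X^~ y) h) x
    (fun v => mpoly.meval (X^~ x) g / mpoly.meval (X^~ x) h *
       \sum_j dlog g h (X^~ x) j * dX j v).
Proof.
move=> hX g0 h0.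
apply: cdiff_eq (cdiffM (cdiff_meval g hX) (cdiffV h0 (cdiff_meval h hX))) _ => v.
under [X in _ = _ * X]eq_bigr do rewrite mulrBl mulrAC [X in _ - X]mulrAC.
rewrite sumrB -!mulr_suml.
move: (\sum_j _) (\sum_j _) => B A.
by move: g0 h0; move: (mpoly.meval _ g) (mpoly.meval _ h) => u w u0 w0; field;
  rewrite u0 w0.
Qed.

End CdiffQuotient.
End ComplexDifferentials.

(** * Milnor sets as critical points of the logarithm *)

Section MilnorSets.
Context {R : realType}.
Local Notation Re := complex.Re.
Local Notation Im := complex.Im.

Lemma is_diff_derive (V W : normedModType R) (f df : V -> W) (x v : V) :
  is_diff x f df -> is_derive x v f (df v).
Proof.
move=> [hf hd]; split; first exact: diff_derivable.
by rewrite deriveE // hd.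
Qed.

Lemma is_diff_sum (V : normedModType R) (I : Type) (s : seq I)
    (f df : I -> V -> R) (x : V) : (forall i, is_diff x (f i) (df i)) ->
  is_diff x (fun y => \sum_(i <- s) f i y) (fun v => \sum_(i <- s) df i v).
Proof.
move=> h; elim: s => [|i s IHs].
  under eq_fun do rewrite big_nil.
  apply: (is_diff_eq (is_diff_cst (0 : R) x)); apply/funext => v.
  by rewrite big_nil.
under eq_fun do rewrite big_cons.
apply: (is_diff_eq (is_diffD (h i) IHs)); apply/funext => v.
by rewrite big_cons.
Qed.

Lemma is_diff_fst (U V : normedModType R) (x : U * V) :
  is_diff x (fun y : U * V => y.1) (fun v : U * V => v.1).
Proof.
have c : continuous (@fst U V) by move=> y; exact: cvg_fst.
split; first exact: (@linear_differentiable _ _ _ fst).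
by rewrite (@diff_lin _ _ _ fst).
Qed.

Lemma is_diff_snd (U V : normedModType R) (x : U * V) :
  is_diff x (fun y : U * V => y.2) (fun v : U * V => v.2).
Proof.
have c : continuous (@snd U V) by move=> y; exact: cvg_snd.
split; first exact: (@linear_differentiable _ _ _ snd).
by rewrite (@diff_lin _ _ _ snd).
Qed.

Lemma is_diff_coord (n : nat) (M : 'rV[R]_n) j :
  is_diff M (fun N : 'rV[R]_n => N 0 j) (fun v : 'rV[R]_n => v 0 j).
Proof.
split; first exact: differentiable_coord.
apply/funext => v; rewrite -deriveE; last exact: differentiable_coord.
apply: cvg_lim => //; apply: cvg_near_cst; near=> t.
have t0 : t != 0 by near: t; exact: nbhs_dnbhs_neq.
by rewrite /GRing.scale /= !mxE addrK mulrA mulVf // mul1r.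
Unshelve. all: by end_near. Qed.

(** Two independent linear forms are jointly surjective: a solution is found in the span of [a] and
    [m] by Cramer's rule, the determinant being the Gram determinant. *)
Lemma gram_solve (I : finType) (a m : I -> R) : 0 < \sum_i a i ^+ 2 ->
  ~ (exists l, forall i, m i = l * a i) -> forall s t, exists v : I -> R,
    \sum_i a i * v i = s /\ \sum_i m i * v i = t.
Proof.
have sq (y z : R) : \sum_i (y * m i - z * a i) ^+ 2 =
    y ^+ 2 * (\sum_i m i ^+ 2) - 2 * y * z * (\sum_i m i * a i) +
    z ^+ 2 * (\sum_i a i ^+ 2).
  rewrite !mulr_sumr -sumrB -big_split /=.
  by apply: eq_bigr => k _; ring.
have dota (y z : R) : \sum_i a i * (y * a i + z * m i) =
    y * (\sum_i a i ^+ 2) + z * (\sum_i m i * a i).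
  by rewrite !mulr_sumr -big_split /=; apply: eq_bigr => k _; ring.
have dotm (y z : R) : \sum_i m i * (y * a i + z * m i) =
    y * (\sum_i m i * a i) + z * (\sum_i m i ^+ 2).
  by rewrite !mulr_sumr -big_split /=; apply: eq_bigr => k _; ring.
move: (\sum_i a i ^+ 2) (\sum_i m i * a i) (\sum_i m i ^+ 2) sq dota dotm.
move=> X c B sq dota dotm X0 indep s t.
have Xn0 : X != 0 by rewrite gt_eqF.
have [d0|d0] := eqVneq (X * B - c ^+ 2) 0.
  exfalso; apply: indep; exists (c / X) => i.
  have : \sum_i (X * m i - c * a i) ^+ 2 = 0.
    (* The squared length of [X m - c a] is [X] times the Gram determinant, so a zero determinant
       forces proportionality. *)
    by rewrite sq -[RHS](mulr0 X) -d0; ring.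
  move/psumr_eq0P => /(_ (fun k _ => sqr_ge0 _) i isT)/eqP.
  rewrite sqrf_eq0 subr_eq0 => /eqP h.
  by apply: (mulfI Xn0); rewrite h; field.
exists (fun i => (s * B - t * c) / (X * B - c ^+ 2) * a i +
                 (t * X - s * c) / (X * B - c ^+ 2) * m i).
by rewrite dota dotm; split; field.
Qed.

(** For F = a + i b of modulus s and derivative p + i q, the derivative of F / s is i (F / s) times
    (a q - b p) / s^2, the derivative of the argument. The factor [- s ^- 2 / (2 * s)] is the
    derivative of the inverse square root at s^2. *)
Lemma sign_derivative (a b p q s : R) : s != 0 -> s ^+ 2 = a ^+ 2 + b ^+ 2 ->
  a * (2 * (a * p + b * q) * (- s ^- 2 / (2 * s))) + s^-1 * p =
    - (b / s) * ((a * q - b * p) / s ^+ 2) /\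
  b * (2 * (a * p + b * q) * (- s ^- 2 / (2 * s))) + s^-1 * q =
    a / s * ((a * q - b * p) / s ^+ 2).
Proof.
move=> s0 e; have si c : s^-1 * c = (a ^+ 2 + b ^+ 2) / s ^+ 3 * c.
  by rewrite -e; field.
by rewrite !si; split; field.
Qed.

(** * Differentials of the squared norm, the quotient and the argument *)

Section Points.
Context {n : nat}.
Implicit Types (g h : cpoly R n) (x v : realCn R n).

Lemma cdiff_zcoord x j :
  cdiff (fun y : realCn R n => zcoord y j) x (fun v : realCn R n => zcoord v j).
Proof.
split.
  exact: (is_diff_comp (is_diff_fst x) (is_diff_coord x.1 j)).
exact: (is_diff_comp (is_diff_snd x) (is_diff_coord x.2 j)).
Qed.

Lemma is_diff_sqenorm x : is_diff x (@sqenorm R n)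
  (fun v => 2 * \sum_j (x.1 0 j * v.1 0 j + x.2 0 j * v.2 0 j)).
Proof.
apply: (is_diff_eq (is_diff_sum (index_enum 'I_n)
  (fun j => is_diff_modulus2 (cdiff_zcoord x j)))).
by apply/funext => v; rewrite mulr_sumr.
Qed.

(* Here [dlog g h z = i l conj z], that is, the gradient of [log (g / h)] is a
   purely imaginary multiple of [z]. *)
Definition crit g h (z : 'I_n -> R[i]) (l : R) :=
  [/\ mpoly.meval z g != 0, mpoly.meval z h != 0 &
    forall j, Re (dlog g h z j) = l * Im (z j) /\
              Im (dlog g h z j) = l * Re (z j)].

(** The sum is i l times the Hermitian product of [w] with [z]; its imaginary part is thus l / 2
    times the differential of the squared norm in the direction [w]. *)
Lemma crit_sum g h z l (w : 'I_n -> R[i]) : crit g h z l ->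
  Re (\sum_j dlog g h z j * w j) =
    l * \sum_j (Im (z j) * Re (w j) - Re (z j) * Im (w j)) /\
  Im (\sum_j dlog g h z j * w j) =
    l * \sum_j (Re (z j) * Re (w j) + Im (z j) * Im (w j)).
Proof.
move=> [_ _ hl]; rewrite Re_sum Im_sum !mulr_sumr.
split; apply: eq_bigr => j _; have [h1 h2] := hl j.
  by rewrite ReM h1 h2; ring.
by rewrite ImM h1 h2; ring.
Qed.

(** If l is nonzero, a vector killed by the differential of f is also killed by that of the squared
    norm, so (1, 0) is not attained. If l = 0, the differential of f is zero and (0, 1) is not
    attained. *)
Lemma crit_milnor_quot g h x l : crit g h (zcoord x) l -> milnor_quot g h x.
Proof.
move=> hc; have [g0 h0 _] := hc; split=> // -[_].
have hq := cdiff_quot (cdiff_zcoord x) g0 h0.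
have hd := is_diff_pair (is_diff_sqenorm x) (is_diff_pair hq.1 hq.2).
rewrite (@diff_val _ _ _ _ _ _ _ hd) => hr.
set f := mpoly.meval (zcoord x) g / mpoly.meval (zcoord x) h in hr.
have f0 : f != 0 by rewrite mulf_neq0 ?invr_eq0.
pose S v := \sum_j dlog g h (zcoord x) j * zcoord v j.
have tgt (s : R) (z : R[i]) : exists v : realCn R n,
    2 * \sum_j (x.1 0 j * v.1 0 j + x.2 0 j * v.2 0 j) = s /\ f * S v = z.
  have : [set: R * realC R] (s, (Re z, Im z)) by [].
  rewrite -hr => -[v _ [h1 h2 h3]]; exists v; split => //.
  exact: complexP.
have [l0|l0] := eqVneq l 0.
  have [v [_ hv]] := tgt 0 1.
  have S0 : S v = 0.
    have [h1 h2] := crit_sum (zcoord v) hc.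
    by apply: complexP; rewrite ?h1 ?h2 l0 mul0r.
  by move: hv; rewrite S0 mulr0 => /eqP; rewrite eq_sym oner_eq0.
have [v [h1 h2]] := tgt 1 0.
have S0 : S v = 0 by apply/eqP; move/eqP: h2; rewrite mulf_eq0 (negPf f0).
have [_ h3] := crit_sum (zcoord v) hc.
move: h3; rewrite -/(S v) S0 => /esym/eqP.
rewrite mulf_eq0 (negPf l0) /= => /eqP h3.
by move: h1; rewrite h3 mulr0 => /eqP; rewrite eq_sym oner_eq0.
Qed.

Lemma toRealC_sign (z : R[i]) : toRealC (z / `|z|) =
  (Re z * (Num.sqrt (Re z ^+ 2 + Im z ^+ 2))^-1,
   Im z * (Num.sqrt (Re z ^+ 2 + Im z ^+ 2))^-1).
Proof.
by rewrite /toRealC normc_def -fmorphV ReM ImM /= !mulr0 subr0 add0r.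
Qed.

(** [th] is the differential of the argument, which g conj(h) shares with g / h. *)
Lemma is_diff_arg_map g h x : peval g x != 0 -> peval h x != 0 ->
  let th (v : realCn R n) := Im (\sum_j dlog g h (zcoord x) j * zcoord v j) in
  is_diff x (fun y => toRealC (arg_map g h y))
   (fun v => (- Im (arg_map g h x) * th v, Re (arg_map g h x) * th v)).
Proof.
move=> g0 h0 th.
have hg := cdiff_meval g (cdiff_zcoord x).
have hh := cdiff_meval h (cdiff_zcoord x).
set Lg := (fun v : realCn R n => \sum_j _) in hg.
set Lh := (fun v : realCn R n => \sum_j _) in hh.
have hF := cdiffM hg (cdiff_conj hh).
set F := (fun y : realCn R n => _ * _) in hF.
set L := (fun v : realCn R n => _ + _) in hF.
have F0 : F x != 0 by rewrite mulf_neq0 // conjc_eq0.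
have N0 := modulus2_gt0 F0.
have hN := is_diff_modulus2 hF.
pose N := Re (F x) ^+ 2 + Im (F x) ^+ 2.
pose s := Num.sqrt N.
have s0 : 0 < s by rewrite sqrtr_gt0.
have sn0 : s != 0 by rewrite gt_eqF.
have e : s ^+ 2 = Re (F x) ^+ 2 + Im (F x) ^+ 2 by rewrite sqr_sqrtr // ltW.
have hphi := is_diff_scal hN
  (is_deriveV (f := Num.sqrt) sn0 (is_derive1_sqrt N0)).
have argE y : toRealC (arg_map g h y) =
    (Re (F y) * (Num.sqrt (Re (F y) ^+ 2 + Im (F y) ^+ 2))^-1,
     Im (F y) * (Num.sqrt (Re (F y) ^+ 2 + Im (F y) ^+ 2))^-1).
  exact: toRealC_sign.
have thE v : th v = (Re (F x) * Im (L v) - Im (F x) * Re (L v)) / s ^+ 2.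
  have -> : th v = Im (L v / F x).
    (* Conjugating the contribution of h reverses its imaginary part, which accounts for the minus
       sign in [dlog]. *)
    have -> : L v / F x = Lg v / peval g x + conjc (Lh v / peval h x).
      rewrite rmorphM fmorphV /=; rewrite /L /F; field.
      by rewrite g0 conjc_eq0 h0.
    rewrite ImD Im_conj -ImN -ImD /th; congr Im.
    rewrite /Lg /Lh !mulr_suml -sumrB; apply: eq_bigr => j _.
    by rewrite /dlog mulrBl mulrAC [X in _ - X]mulrAC.
  rewrite (ImM (L v)) ReV ImV -e; field.
  exact: sn0.
have [hF1 hF2] := hF.
under [X in is_diff_def _ X]eq_fun do rewrite argE.
apply: (is_diff_eq (is_diff_pair (is_diffM hF1 hphi) (is_diffM hF2 hphi))).
have [reE imE] : Re (arg_map g h x) = Re (F x) / s /\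
    Im (arg_map g h x) = Im (F x) / s.
  by split; [exact: (congr1 fst (argE x))|exact: (congr1 snd (argE x))].
apply/funext => v; rewrite !fctE /GRing.scale /= reE imE thE -/N -/s.
have [d1 d2] := sign_derivative (Re (L v)) (Im (L v)) sn0 e.
by congr pair; [exact: d1|exact: d2].
Qed.

(** Away from the origin the differential of the squared norm is nonzero. If [th] is not a multiple
    of it, the two forms take arbitrary values jointly, and the pair is a submersion. *)
Lemma milnor_arg_crit g h x : milnor_arg g h x -> 0 < sqenorm x ->
  exists l, crit g h (zcoord x) l.
Proof.
move=> [gh0 nsub] x0.
have g0 : peval g x != 0 by apply: contraNneq gh0 => ->; rewrite mul0r.
have h0 : peval h x != 0 by apply: contraNneq gh0 => ->; rewrite mulr0.
apply: contrapT => ncrit; apply: nsub.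
have hd := is_diff_pair (is_diff_sqenorm x) (is_diff_arg_map g0 h0).
split; first exact: (@ex_diff _ _ _ _ _ _ _ hd).
rewrite (@diff_val _ _ _ _ _ _ _ hd).
set P := Re (arg_map g h x); set Q := Im (arg_map g h x).
have PQ : P ^+ 2 + Q ^+ 2 = 1.
  have F0 : peval g x * conjc (peval h x) != 0 by rewrite mulf_neq0 // conjc_eq0.
  apply: complexI; rewrite /P /Q add_Re2_Im2 /arg_map.
  by rewrite normrM normfV normr_id mulfV ?normr_eq0 // expr1n.
apply/seteqP; split=> [_ [v _ <-]|[s [p q]] [_ /= hpq]].
  by split=> //=; rewrite /tangent_circle /= -/P -/Q; ring.
pose a (k : 'I_n + 'I_n) := match k with inl j => x.1 0 j | inr j => x.2 0 j end.
(* The coefficients of [th] as a real linear form in the real and imaginary parts of the vector. *)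
pose m (k : 'I_n + 'I_n) := match k with
  inl j => Im (dlog g h (zcoord x) j) | inr j => Re (dlog g h (zcoord x) j) end.
have a0 : 0 < \sum_k a k ^+ 2 by rewrite big_sumType /= -big_split.
have ind : ~ exists l, forall k, m k = l * a k.
  move=> [l hl]; apply: ncrit; exists l; split=> // j.
  by split; [exact: hl (inr j)|exact: hl (inl j)].
(* [s / 2] because the differential of the squared norm is twice the first form; [- Q * p + P * q]
   is the coordinate of (p, q) along the unit tangent (-Q, P). *)
have [w [hw1 hw2]] := gram_solve a0 ind (s / 2) (- Q * p + P * q).
exists (\row_j w (inl j), \row_j w (inr j)) => //=.
congr pair.
  rewrite -[RHS](mulfVK (_ : 2 != 0)) ?pnatr_eq0 // mulrC; congr (_ * _).
  by rewrite -hw1 big_sumType /= -big_split; apply: eq_bigr => j _; rewrite !mxE.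
have -> : Im (\sum_j dlog g h (zcoord x) j *
    zcoord (\row_j w (inl j), \row_j w (inr j)) j) = - Q * p + P * q.
  rewrite Im_sum -hw2 big_sumType /= -big_split; apply: eq_bigr => j _.
  by rewrite ImM /= !mxE addrC.
have hpq' : P * p + Q * q = 0 by [].
congr pair.
  have -> : - Q * (- Q * p + P * q) =
    (P ^+ 2 + Q ^+ 2) * p - P * (P * p + Q * q) by ring.
  by rewrite PQ hpq' mulr0 subr0 mul1r.
have -> : P * (- Q * p + P * q) =
  (P ^+ 2 + Q ^+ 2) * q - Q * (P * p + Q * q) by ring.
by rewrite PQ hpq' mulr0 subr0 mul1r.
Qed.

End Points.
End MilnorSets.

(** * Critical curves *)

Section CriticalCurves.
Context {R : realType} {n : nat}.
Implicit Types (g h : cpoly R n) (a b : 'I_n -> R -> R) (l : R -> R).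
Local Notation Re := complex.Re.
Local Notation Im := complex.Im.

Definition cdterm (T : (nat -> R) -> R[i]) :=
  dterm (fun E => Re (T E)) /\ dterm (fun E => Im (T E)).

Lemma cdterm_const c : cdterm (fun=> c).
Proof. by split; exact: dterm_const. Qed.

Lemma cdtermD T1 T2 : cdterm T1 -> cdterm T2 -> cdterm (fun E => T1 E + T2 E).
Proof.
move=> [h1 h2] [h3 h4]; split.
  by under eq_fun do rewrite ReD; exact: dtermD.
by under eq_fun do rewrite ImD; exact: dtermD.
Qed.

Lemma cdtermM T1 T2 : cdterm T1 -> cdterm T2 -> cdterm (fun E => T1 E * T2 E).
Proof.
move=> [h1 h2] [h3 h4]; split.
  by under eq_fun do rewrite ReM; apply: dtermB; exact: dtermM.
by under eq_fun do rewrite ImM; apply: dtermD; exact: dtermM.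
Qed.

Lemma cdtermV T : cdterm T -> cdterm (fun E => (T E)^-1).
Proof.
move=> [h1 h2].
have d : dterm (fun E => (Re (T E) ^+ 2 + Im (T E) ^+ 2)^-1).
  by apply: dtermV; apply: dtermD; exact: dtermX.
split.
  by under eq_fun do rewrite ReV; exact: dtermM.
by under eq_fun do rewrite ImV; apply: dtermM => //; exact: dtermN.
Qed.

Lemma cdterm_meval (p : mpoly.mpoly n R[i]) (T : 'I_n -> (nat -> R) -> R[i]) :
  (forall j, cdterm (T j)) -> cdterm (fun E => mpoly.meval (T^~ E) p).
Proof.
move=> dT; elim/(@mpoly_ring_ind R n): p => [c|k|p q hp hq|p q hp hq].
- by under eq_fun do rewrite mpoly.mevalC; exact: cdterm_const.
- by under eq_fun do rewrite mpoly.mevalXU; exact: dT.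
- by under eq_fun do rewrite mpoly.mevalD; exact: cdtermD.
- by under eq_fun do rewrite mpoly.mevalM; exact: cdtermM.
Qed.

Lemma definable_forall_fin (I : finType) (S : I -> (nat -> R) -> Prop) :
  (forall i, definable (S i)) -> definable (fun E => forall i, S i E).
Proof.
move=> dS.
suff: definable (fun E => forall i, i \in enum I -> S i E).
  by apply: definable_ext => E; split=> h i //; apply: h; rewrite mem_enum.
elim: (enum I) => [|i s IHs].
  apply: definable_ext (definable_eq (dterm_const (0 : R)) (dterm_const 0)) => E.
  by split.
apply: definable_ext (definable_and (dS i) IHs) => E; split.
  by move=> [h1 h2] k; rewrite in_cons => /predU1P[->|/h2].
by move=> h; split=> [|k ks]; apply: h; rewrite in_cons ?eqxx ?ks ?orbT.
Qed.

Lemma definable_crit g h (T : 'I_n -> (nat -> R) -> R[i]) L :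
  (forall j, cdterm (T j)) -> dterm L ->
  definable (fun E => crit g h (T^~ E) (L E)).
Proof.
move=> dT dL.
have dm p := cdterm_meval p dT.
have neq0 (U : (nat -> R) -> R[i]) : cdterm U -> definable (fun E => U E != 0).
  move=> [h1 h2]; have := definable_not (definable_and
    (definable_eq h1 (dterm_const 0)) (definable_eq h2 (dterm_const 0))).
  apply: definable_ext => E; split=> [k|/eqP k [k1 k2]].
    by apply/eqP => k1; apply: k; rewrite k1.
  by apply: k; exact: complexP.
have dd j : cdterm (fun E => dlog g h (T^~ E) j).
  apply: cdtermD; first by apply: cdtermM; [exact: dm|exact: cdtermV].
  have : cdterm (fun E => (-1) *
    (mpoly.meval (T^~ E) (mpoly.mderiv j h) / mpoly.meval (T^~ E) h)).
    apply: cdtermM; first exact: cdterm_const.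
    by apply: cdtermM; [exact: dm|exact: cdtermV].
  by under eq_fun do rewrite mulN1r.
have dall : definable (fun E => forall j,
    Re (dlog g h (T^~ E) j) = L E * Im (T j E) /\
    Im (dlog g h (T^~ E) j) = L E * Re (T j E)).
  apply: definable_forall_fin => j; apply: definable_and; apply: definable_eq.
  - exact: (dd j).1.
  - by apply: dtermM => //; exact: (dT j).2.
  - exact: (dd j).2.
  - by apply: dtermM => //; exact: (dT j).1.
have := definable_and (neq0 _ (dm g)) (definable_and (neq0 _ (dm h)) dall).
by apply: definable_ext => E; split=> [[? [? ?]]|[]].
Qed.

Definition curve a b r : 'I_n -> R[i] := fun j => (a j r +i* b j r)%C.

Definition crit_curve g h a b l := \forall r \near +oo,
  crit g h (curve a b r) (l r) /\ \sum_j (a j r ^+ 2 + b j r ^+ 2) = r.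

Lemma crit_curve_selection g h :
  (forall K : R, exists x (l : R), K < sqenorm x /\ crit g h (zcoord x) l) ->
  exists a b l, [/\ forall j, dfun (a j), forall j, dfun (b j) &
    crit_curve g h a b l].
Proof.
move=> hunb.
pose z (j : 'I_n) (E : nat -> R) := (E j +i* E (n + j)%N)%C.
(* Layout of the variables: n real parts, n imaginary parts, the multiplier l, and last the
   parameter r, which stays free when the first 2n + 1 are chosen. *)
pose S (E : nat -> R) := crit g h (z^~ E) (E (n + n)%N) /\
  \sum_(j < n) (E j ^+ 2 + E (n + j)%N ^+ 2) = E (n + n).+1.
have dS : definable S.
  apply: definable_and.
    apply: definable_crit; last exact: dterm_var.
    by move=> j; split; exact: dterm_var.
  apply: definable_eq; last exact: dterm_var.
  by apply: dterm_sum => j; apply: dtermD; apply: dtermX; exact: dterm_var.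
have [c [dc hc]] := definable_choice_seq (n + n).+1 dS.
pose E0 (r : R) : nat -> R := r .: fun=> 0.
pose w r := sapp (mkseq (c^~ (E0 r)) (n + n).+1) (E0 r).
have wlt r i : (i < (n + n).+1)%N -> w r i = c i (E0 r).
  by move=> hi; rewrite /w sapp_nth size_mkseq hi nth_mkseq.
have wr r : w r (n + n).+1 = r.
  by rewrite /w sapp_nth size_mkseq ltnn subnn.
have dw : dset (fun r => S (w r)).
  pose sg i (E : nat -> R) := sapp (mkseq (c^~ (E 0%N .: fun=> 0)) (n + n).+1)
    (E 0%N .: fun=> 0) i.
  apply: (definable_subst (sigma := sg) dS) => i.
  rewrite /sg; under eq_fun do rewrite sapp_nth size_mkseq.
  case: ltnP => hi.
    under eq_fun do rewrite nth_mkseq //.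
    exact: (dfun_dterm (dc i)).
  by case: (i - _)%N => [|k]; [exact: dterm_var|exact: dterm_const].
have near_w : \forall r \near +oo, S (w r).
  apply: dset_frequently => // K; have [x [l [Kx cx]]] := hunb K.
  exists (sqenorm x) => //; apply: hc.
  pose co (i : nat) : R := if insub i is Some j then x.1 0 j else
    if insub (i - n)%N is Some j then x.2 0 j else l.
  exists (mkseq co (n + n).+1); first by rewrite size_mkseq.
  have e1 (j : 'I_n) : sapp (mkseq co (n + n).+1) (E0 (sqenorm x)) j = x.1 0 j.
    rewrite sapp_nth size_mkseq ltnS (leq_trans (ltnW (ltn_ord j))) ?leq_addr //.
    rewrite nth_mkseq ?ltnS ?(leq_trans (ltnW (ltn_ord j))) ?leq_addr //.
    by rewrite /co valK.
  have e2 (j : 'I_n) :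
      sapp (mkseq co (n + n).+1) (E0 (sqenorm x)) (n + j)%N = x.2 0 j.
    rewrite sapp_nth size_mkseq ltnS leq_add2l (ltnW (ltn_ord j)).
    rewrite nth_mkseq ?ltnS ?leq_add2l ?(ltnW (ltn_ord j)) //.
    by rewrite /co insubN -?leqNgt ?leq_addr // addKn valK.
  have e3 : sapp (mkseq co (n + n).+1) (E0 (sqenorm x)) (n + n)%N = l.
    rewrite sapp_nth size_mkseq ltnS leqnn nth_mkseq //.
    by rewrite /co !insubN // -leqNgt ?addKn ?leq_addr.
  have e4 : sapp (mkseq co (n + n).+1) (E0 (sqenorm x)) (n + n).+1 = sqenorm x.
    by rewrite sapp_nth size_mkseq ltnn subnn.
  split; rewrite ?e3 ?e4; last by apply: eq_bigr => j _; rewrite e1 e2.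
  rewrite (_ : z^~ _ = zcoord x) //; apply/funext => j.
  by rewrite /z e1 e2.
exists (fun j r => c j (E0 r)), (fun j r => c (n + j)%N (E0 r)),
  (fun r => c (n + n)%N (E0 r)).
split=> [j|j|]; [exact: dfun_dterm|exact: dfun_dterm|].
have jlt (j : 'I_n) : (j < (n + n).+1)%N.
  by rewrite ltnS (leq_trans (ltnW (ltn_ord j))) ?leq_addr.
have njlt (j : 'I_n) : (n + j < (n + n).+1)%N.
  by rewrite ltnS leq_add2l ltnW.
apply: filterS near_w => r [h1 h2]; split.
  move: h1; rewrite wlt // (_ : z^~ (w r) = curve
    (fun j r => c j (E0 r)) (fun j r => c (n + j)%N (E0 r)) r) //.
  by apply/funext => j; rewrite /z !wlt.
rewrite -[RHS](wr r) -h2; apply: eq_bigr => j _.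
by rewrite !wlt.
Qed.

(** Differentiating an identity at r requires it on a neighbourhood of r. *)
Lemma near_pinfty_nbhs (A : R -> Prop) : (\forall r \near +oo, A r) ->
  \forall r \near +oo, \forall s \near r, A s.
Proof.
move=> [M [Mr hM]]; exists M; split=> // r /= /lt_nbhsr.
by apply: filterS => s; exact: hM.
Qed.

Lemma is_derive_unique (f : R -> R) (r d1 d2 : R) :
  is_derive r 1 f d1 -> is_derive r 1 f d2 -> d1 = d2.
Proof. by move=> [_ <-] [_ <-]. Qed.

Lemma dfun_curve_quot g h a b :
  (forall j, dfun (a j)) -> (forall j, dfun (b j)) ->
  let f r := mpoly.meval (curve a b r) g / mpoly.meval (curve a b r) h in
  dfun (fun r => Re (f r)) /\ dfun (fun r => Im (f r)).
Proof.
move=> da db f.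
have dT j : cdterm (fun E : nat -> R => curve a b (E 0%N) j).
  by split; [exact: da|exact: db].
exact: cdtermM (cdterm_meval g dT) (cdtermV (cdterm_meval h dT)).
Qed.

Lemma crit_curve_slow g h a b l :
  (forall j, dfun (a j)) -> (forall j, dfun (b j)) -> crit_curve g h a b l ->
  let f r := mpoly.meval (curve a b r) g / mpoly.meval (curve a b r) h in
  let F r := Re (f r) ^+ 2 + Im (f r) ^+ 2 in
  exists F' : R -> R,
    (\forall r \near +oo, is_derive (r : R) (1 : R) F (F' r)) /\
    forall e : R, 0 < e -> \forall r \near +oo, `|r * F' r| <= e * F r.
Proof.
move=> da db hc f F.
have [du dv] := dfun_curve_quot g h da db.
have [u' du' hu'] := dfun_derive du.
have [v' dv' hv'] := dfun_derive dv.
have exd (c : 'I_n -> R -> R) : (forall j, dfun (c j)) ->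
    exists c' : 'I_n -> R -> R,
    (forall j, dfun (c' j)) /\
    \forall r \near +oo, forall j, is_derive (r : R) (1 : R) (c j) (c' j r).
  move=> dc; have ex j : exists c'j, dfun c'j /\
      \forall r \near +oo, is_derive (r : R) (1 : R) (c j) (c'j r).
    by have [d ? ?] := dfun_derive (dc j); exists d.
  have [c' hc'] := choice ex; exists c'; split=> [j|]; first exact: (hc' j).1.
  by apply: filter_forall => j; exact: (hc' j).2.
have [a' [da' ha']] := exd a da.
have [b' [db' hb']] := exd b db.
(* [s] is - Im <z', z>, and [p + i l / 2] will be the logarithmic derivative of f along the
   curve. *)
pose s r := \sum_j (b j r * a' j r - a j r * b' j r).
pose p r := l r * s r.
have key : \forall r \near +oo, [/\ 0 < r, `|s r| <= 1,
    u' r = Re (f r) * p r - Im (f r) * (l r / 2) &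
    v' r = Re (f r) * (l r / 2) + Im (f r) * p r].
  (* Summed over j, the right-hand sides give |z|^2 = r, whence |s| <= 1. *)
  have hs : \forall r \near +oo, forall j,
     `|r * (b j r * a' j r - a j r * b' j r)| <= 1 * (b j r ^+ 2 + a j r ^+ 2).
    apply: filter_forall => j; apply: dfun_no_spiral => //.
      by apply: filterS hb' => r.
    by apply: filterS ha' => r.
  have hsq := near_pinfty_nbhs hc.
  near=> r.
  have r0 : 0 < r by near: r; exact: nbhs_pinfty_gt.
  have [cr sr] : crit g h (curve a b r) (l r) /\
    \sum_j (a j r ^+ 2 + b j r ^+ 2) = r by near: r.
  have har : forall j, is_derive (r : R) (1 : R) (a j) (a' j r) by near: r.
  have hbr : forall j, is_derive (r : R) (1 : R) (b j) (b' j r) by near: r.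
  have hsr : forall j,
     `|r * (b j r * a' j r - a j r * b' j r)| <= 1 * (b j r ^+ 2 + a j r ^+ 2).
    by near: r.
  have hcd j : cdiff (fun t => curve a b t j) r
      (fun k => (k * a' j r +i* (k * b' j r))%C).
    by split; [exact: is_derive_diff (har j)|exact: is_derive_diff (hbr j)].
  have half : \sum_j (a j r * a' j r + b j r * b' j r) = 1 / 2.
    have d1 := is_diff_derive (1 : R) (is_diff_sum (index_enum 'I_n)
      (fun j => is_diff_modulus2 (hcd j))).
    have d2 : is_derive (r : R) (1 : R)
        (fun t => \sum_(j < n) (a j t ^+ 2 + b j t ^+ 2)) (1 : R).
      apply: near_eq_is_derive (is_derive_id (r : R) (1 : R)).
      have : \forall t \near r, crit g h (curve a b t) (l t) /\
        \sum_j (a j t ^+ 2 + b j t ^+ 2) = t by near: r.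
      by apply: filterS => t [_ ->].
    have e1 : 2 * \sum_j (a j r * a' j r + b j r * b' j r) = 1.
      rewrite mulr_sumr -[RHS](is_derive_unique d1 d2).
      by apply: eq_bigr => j _; rewrite /= !mul1r.
    by move: e1; move: (\sum_j _) => t; lra.
  have [g0 h0 _] := cr.
  have [d1 d2] := cdiff_quot hcd g0 h0.
  have [c1 c2] := crit_sum (fun j => (1 * a' j r +i* (1 * b' j r))%C) cr.
  have rep : Re (\sum_j dlog g h (curve a b r) j *
      (1 * a' j r +i* (1 * b' j r))%C) = p r.
    by rewrite c1 /p /s; congr (_ * _); apply: eq_bigr => j _ /=; rewrite !mul1r.
  have imp : Im (\sum_j dlog g h (curve a b r) j *
      (1 * a' j r +i* (1 * b' j r))%C) = l r / 2.
    rewrite c2 -[in RHS](div1r 2) -half; congr (_ * _); apply: eq_bigr => j _ /=.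
    by rewrite !mul1r.
  split=> //.
  - rewrite -(ler_pM2l r0) mulr1 -{1}(gtr0_norm r0) -normrM /s mulr_sumr.
    apply: le_trans (ler_norm_sum _ _ _) _; rewrite -[leRHS]sr.
    by apply: ler_sum => j _; apply: le_trans (hsr j) _; rewrite mul1r addrC.
  - have hu'r : is_derive (r : R) (1 : R) (fun t => Re (f t)) (u' r) by near: r.
    rewrite (is_derive_unique hu'r (is_diff_derive (1 : R) d1)).
    by rewrite (ReM (f r)) rep imp.
  - have hv'r : is_derive (r : R) (1 : R) (fun t => Im (f t)) (v' r) by near: r.
    rewrite (is_derive_unique hv'r (is_diff_derive (1 : R) d2)).
    by rewrite (ImM (f r)) rep imp.
exists (fun r => 2 * (Re (f r) * u' r + Im (f r) * v' r)); split.
  apply: filterS (filterI hu' hv') => r [h1 h2].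
  apply: (is_derive_eq (is_deriveD (is_deriveM h1 h1) (is_deriveM h2 h2))).
  by rewrite /GRing.scale /=; ring.
(* The factor 4 absorbs the 2 in l / 2 and the 2 from differentiating a square. *)
move=> e e0; have e4 : 0 < e / 4 by rewrite divr_gt0.
have spiral := dfun_no_spiral du dv du' dv' hu' hv' e4.
apply: filterS (filterI (filterI key spiral) hc) =>
  r [[[r0 s1 hu hv] sp] [[g0 h0 _] _]].
have F0 : 0 < F r by apply: modulus2_gt0; rewrite mulf_neq0 // invr_eq0.
have lr : `|r * l r| <= e / 2.
  rewrite -(ler_pM2r F0); move: sp.
  have -> : r * (Re (f r) * v' r - Im (f r) * u' r) = r * l r * F r / 2.
    by rewrite hu hv /F; field.
  rewrite -/(F r) 2!normrM (gtr0_norm F0) [`|2^-1|]gtr0_norm // => sp.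
  by have -> : e / 2 = e / 4 * 2 by [field]; move: sp; lra.
have -> : r * (2 * (Re (f r) * u' r + Im (f r) * v' r)) =
    2 * (r * l r) * s r * F r.
  by rewrite hu hv /F /p; ring.
rewrite 2!normrM (gtr0_norm F0) ler_pM2r // normrM [`|2|]gtr0_norm //.
have : `|r * l r| * `|s r| <= e / 2 * 1 by exact: ler_pM.
by lra.
Unshelve. all: by end_near. Qed.

End CriticalCurves.

(** * Boundedness *)

Section Boundedness.
Context {R : realType} {n : nat}.
Implicit Types (g h : cpoly R n).
Local Notation Re := complex.Re.
Local Notation Im := complex.Im.

(** [bounded_set] refers to the sup norm, which the Euclidean norm dominates. *)
Lemma norm_le_sqenorm (x : realCn R n) (M : R) :
  0 <= M -> sqenorm x <= M ^+ 2 -> `|x| <= M.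
Proof.
move=> M0 xM.
have coord j : `|x.1 0 j| <= M /\ `|x.2 0 j| <= M.
  have hj : x.1 0 j ^+ 2 + x.2 0 j ^+ 2 <= M ^+ 2.
    apply: le_trans xM; rewrite /sqenorm (bigD1 j) //= lerDl sumr_ge0 // => k _.
    by rewrite addr_ge0 ?sqr_ge0.
  split; rewrite -(ler_pXn2r (n := 2)) ?nnegrE // real_normK ?num_real //;
    apply: le_trans hj; first by rewrite lerDl sqr_ge0.
  by rewrite lerDr sqr_ge0.
rewrite prod_normE ge_max; apply/andP; split.
  rewrite /Num.norm /= mx_normrE; apply: bigmax_le => // -[i j] _ /=.
  by rewrite ord1; exact: (coord j).1.
rewrite /Num.norm /= mx_normrE; apply: bigmax_le => // -[i j] _ /=.
by rewrite ord1; exact: (coord j).2.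
Qed.

Lemma unbounded_crit g h : ~ bounded_set (milnor_arg g h) ->
  forall K : R, exists x (l : R), K < sqenorm x /\ crit g h (zcoord x) l.
Proof.
move=> nb K; apply: contrapT => hK; apply: nb.
(* The 1 keeps the points found away from the origin and ensures M <= M^2. *)
pose K0 := Num.max K 1.
have K0_1 : 1 <= K0 by rewrite le_max lexx orbT.
exists K0; split; first by rewrite num_real.
move=> M KM x hx.
have M0 : 0 <= M by rewrite ltW // (lt_trans _ KM) // (lt_le_trans ltr01).
apply: norm_le_sqenorm => //.
rewrite leNgt; apply/negP => Mx; apply: hK.
have xK : K0 < sqenorm x.
  apply: lt_trans Mx; apply: (lt_le_trans KM).
  by rewrite expr2 ler_peMl // ltW // (le_lt_trans K0_1).
have [l hl] := milnor_arg_crit hx (lt_trans (lt_le_trans ltr01 K0_1) xK).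
by exists x, l; split=> //; apply: le_lt_trans xK; rewrite le_max lexx.
Qed.

Lemma crit_curve_asymp g h (a b : 'I_n -> R -> R) (l : R -> R) (u v : R) :
  crit_curve g h a b l ->
  let f r := mpoly.meval (curve a b r) g / mpoly.meval (curve a b r) h in
  Re (f r) @[r --> +oo] --> u -> Im (f r) @[r --> +oo] --> v ->
  asymp_nonregular_values g h (u +i* v)%C.
Proof.
move=> hc f hu hv; have [M M0 hM] := near_pinfty_pos hc.
pose t (j : nat) : R := j%:R + M.
have tM j : M <= t j by rewrite /t lerDr.
have t_pinfty : t j @[j --> \oo] --> +oo.
  apply/cvgryPge => A; near=> j.
  have : A <= j%:R by near: j; exact: nbhs_infty_ger.
  by move=> /le_trans; apply; rewrite /t lerDl ltW.
pose x j : realCn R n := (\row_i a i (t j), \row_i b i (t j)).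
have xE j : zcoord (x j) = curve a b (t j).
  by apply/funext => i; rewrite /zcoord /curve !mxE.
exists x; split=> [j||].
- apply: (@crit_milnor_quot _ _ _ _ _ (l (t j))).
  by rewrite xE; exact: (hM _ (tM j)).1.
- have e j : enorm (x j) = Num.sqrt (t j).
    rewrite /enorm /sqenorm; congr Num.sqrt.
    rewrite -[RHS](hM _ (tM j)).2; apply: eq_bigr => i _.
    by rewrite !mxE.
  under eq_fun do rewrite e.
  apply/cvgryPge => A; near=> j.
  have [A0|A0] := lerP A 0; first by rewrite (le_trans A0) // sqrtr_ge0.
  rewrite -(ger0_norm (ltW A0)) -sqrtr_sqr ler_wsqrtr //.
  by near: j; move/cvgryPge: t_pinfty; apply.
- have e j : toRealC (pquot g h (x j)) = (Re (f (t j)), Im (f (t j))).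
    by rewrite /toRealC /pquot /peval xE.
  under eq_fun do rewrite e.
  apply: (@cvg_pair _ _ _ _ (nbhs u) (nbhs v)).
    exact: (cvg_comp _ _ t_pinfty hu).
  exact: (cvg_comp _ _ t_pinfty hv).
Unshelve. all: by end_near. Qed.

End Boundedness.

Unset Implicit Arguments.
Set Strict Implicit.
Set Printing Implicit Defensive.

Theorem corollary4p6 (R : realType) (n : nat) (g h : cpoly R n)
    (hN0 : ~ (forall x : realCn R n, peval h x = 0))
    (hS : asymp_nonregular_values g h `<=` [set 0]) :
  bounded_set (milnor_arg g h).
Proof.
apply: contrapT => /unbounded_crit/crit_curve_selection[a [b [l [da db hc]]]].
pose f r := mpoly.meval (curve a b r) g / mpoly.meval (curve a b r) h.
pose F r := complex.Re (f r) ^+ 2 + complex.Im (f r) ^+ 2.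
have [du dv] := dfun_curve_quot g h da db.
have dF : dfun F by apply: dtermD; exact: dtermX.
have [F' [hF' hslow]] := crit_curve_slow da db hc.
have F0 : \forall r \near +oo, 0 < F r.
  apply: filterS hc => r [[g0 h0 _] _].
  by apply: modulus2_gt0; rewrite mulf_neq0 // invr_eq0.
have large (G : R -> R) : dfun G ->
    ~ (forall M : R, \forall r \near +oo, M < G r) ->
    exists M : R, \forall r \near +oo, G r <= M.
  move=> dG /existsNP[M nM]; exists M.
  have dM : dset (fun r => M < G r) by exact: definable_lt (dterm_const M) dG.
  have [//|] := dset_near dM; apply: filterS => r /negP.
  by rewrite -leNgt.
have [M hM] : exists M : R, \forall r \near +oo, F r <= M.
  apply: large => // hinf; apply: (dfun_subpoly_false dF hinf hF') => e e0.
  by apply: filterS (hslow e e0) => r; apply: le_trans; exact: ler_norm.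
(* This keeps |f| away from 0: the inverse of F has derivative - F' / F^2, so it varies as slowly as
   F. *)
have [N hN] : exists N : R, \forall r \near +oo, (F r)^-1 <= N.
  have dV : dfun (fun r => (F r)^-1) by exact: dtermV.
  apply: large => // hinf.
  apply: (dfun_subpoly_false dV hinf (b := fun r => - (F r) ^- 2 * F' r)).
    apply: filterS (filterI F0 hF') => r [Fr0 hr].
    by apply: (is_deriveV _ hr); rewrite gt_eqF.
  move=> e e0; apply: filterS (filterI F0 (hslow e e0)) => r [Fr0 hr].
  have -> : r * (- (F r) ^- 2 * F' r) = - (r * F' r) / F r ^+ 2.
    by field; rewrite gt_eqF.
  rewrite ler_pdivrMr ?exprn_gt0 //.
  have -> : e / F r * F r ^+ 2 = e * F r by field; rewrite gt_eqF.
  by apply: le_trans hr; rewrite -normrN ler_norm.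
have bd (w : R -> R) : (\forall r \near +oo, w r ^+ 2 <= F r) ->
    \forall r \near +oo, `|w r| <= M + 1.
  move=> hw; apply: filterS (filterI (filterI F0 hw) hM) => r [[Fr0 hwr] FM].
  have M0 : 0 < M by exact: lt_le_trans FM.
  rewrite -(ler_pXn2r (n := 2)) ?nnegrE ?addr_ge0 ?(ltW M0) //.
  rewrite real_normK ?num_real //; apply: (le_trans hwr); apply: (le_trans FM).
  by have := sqr_ge0 M; rewrite sqrrD1; lra.
have [u hu] : exists u : R, complex.Re (f r) @[r --> +oo] --> u.
  apply: (dfun_bounded_cvg du (C := M + 1)); apply: bd; near=> r.
  by rewrite lerDl sqr_ge0.
have [v hv] : exists v : R, complex.Im (f r) @[r --> +oo] --> v.
  apply: (dfun_bounded_cvg dv (C := M + 1)); apply: bd; near=> r.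
  by rewrite lerDr sqr_ge0.
(* The hypothesis forces the limit of f to be 0, so F tends to 0 although its inverse is bounded by
   [N]. *)
have /hS /= [u0 v0] := crit_curve_asymp hc hu hv.
have Fcvg : F r @[r --> +oo] --> (0 : R).
  have -> : (0 : R) = u * u + v * v by rewrite u0 v0 !mulr0 addr0.
  by apply: cvgD; apply: cvgM.
have N1 : 0 < `|N| + 1 by rewrite ltr_wpDl.
have /cvgrPdist_lt/(_ (`|N| + 1)^-1) := Fcvg; rewrite invr_gt0 => /(_ N1) Fsmall.
have [r [/= [Fr0 FN] Fs]] := filter_ex (filterI (filterI F0 hN) Fsmall).
move: Fs; rewrite sub0r normrN gtr0_norm // => Fs.
have : `|N| + 1 < (F r)^-1 by rewrite -[ltLHS]invrK ltf_pV2 ?posrE // invr_gt0.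
by move=> /lt_le_trans/(_ FN); have := ler_norm N; lra.
Unshelve. all: by end_near. Qed.
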